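(* Let $(X,\mu)$ be a standard probability space, $\Lambda\le\Gamma$ countable groups, and $\Gamma\curvearrowright(X,\mu)$ a probability measure-preserving action. Then: (i) if $\Lambda$ is coamenable in $\Gamma$, then $\mathcal R_{\Lambda,X}$ is everywhere coamenable in $\mathcal R_{\Gamma,X}$; (ii) if $\Gamma\curvearrowright(X,\mu)$ is essentially free and $\Lambda$ is not coamenable in $\Gamma$, then for every measurable $E\subseteq X$ with $\mu(E)>0$ we have that $\mathcal R_{\Lambda,X}|_E$ is not coamenable in $\mathcal R_{\Gamma,X}|_E$.
   Context: For a (Borel) probability measure-preserving (pmp) action of a countable group $\Gamma$ on $(X,\mu)$, $\mathcal R_{\Gamma,X}=\{(x,gx):g\in\Gamma,x\in X\}$ is a discrete pmp equivalence relation. The action is essentially free if a.e. point has trivial stabilizer. A subgroup $\Lambda\le\Gamma$ is coamenable if there is a $\Gamma$-invariant mean on $\ell^\infty(\Gamma/\Lambda)$ (equivalently, the action $\Gamma\curvearrowright\Gamma/\Lambda$ admits a Følner sequence; equivalently $\ell^2(\Gamma/\Lambda)$ has almost invariant unit vectors). A discrete pmp equivalence relation on $(X,\mu)$ is a Borel set $\mathcal R\subseteq X\times X$ which is an equivalence relation with countable classes $[x]_{\mathcal R}$ satisfying $\int_X\sum_{y\in[x]_{\mathcal R}}f(x,y)\,d\mu(x)=\int_X\sum_{y\in[x]_{\mathcal R}}f(y,x)\,d\mu(x)$ for all Borel $f\colon\mathcal R\to[0,\infty]$. $\mathcal S\le\mathcal R$ means $\mathcal S$ is a Borel subset of $\mathcal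 R$ that is an equivalence relation on $X$. The full group $[\mathcal R]$ consists of the bimeasurable bijections $\gamma$ of $X$ with $\gamma(x)\in[x]_{\mathcal R}$ for a.e. $x$, modulo a.e. equality. For measurable $E$ with $\mu(E)>0$, $\mathcal R|_E=\mathcal R\cap(E\times E)$ is a discrete pmp relation on $(E,\mu(E\cap\cdot)/\mu(E))$. $[x]_{\mathcal R}/\mathcal S$ is the set of $\mathcal S$-classes contained in $[x]_{\mathcal R}$; $\mathcal R/\mathcal S=\{(x,c):x\in X,c\in[x]_{\mathcal R}/\mathcal S\}$, with the standard Borel structure in which $E$ is Borel iff $\{x:(x,[\gamma(x)]_{\mathcal S})\in E\}$ is Borel for every Borel $\gamma\in[\mathcal R]$, and with the measure $\mu_{\mathcal R/\mathcal S}(E)=\int_X|\{c:(x,c)\in E\}|\,d\mu(x)$. For $\xi\in L^2(\mathcal R/\mathcal S)$ put $\xi_x(c)=\xi(x,c)$, $\xi_x\in\ell^2([x]_{\mathcal R}/\mathcal S)$. $\mathcal S$ is coamenable in $\mathcal R$ if there is a sequence $\xi^{(n)}\in L^2(\mathcal R/\mathcal S)$ with $\|\xi^{(n)}_x\|_2=1$ for a.e. $x\in X$ and $\|\xi^{(n)}_x-\xi^{(n)}_y\|_2\to_{n\to\infty}0$ for $\mu_{\mathcal R}$-a.e. $(x,y)\in\mathcal R$, where $\mu_{\mathcal R}(E)=\int_X|\{y:(x,y)\in E\}|\,d\mu(x)$. $\mathcal S$ is everywhere coamenable in $\mathcal R$ if $\mathcal S|_E$ is coamenable in $\mathcal R|_E$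 for every measurable $E\subseteq X$ with $\mu(E)>0$. *)

(* Defs.v *)
From HB Require Import structures.
From mathcomp Require Import all_boot all_order all_algebra.
From mathcomp Require Import complex.
From mathcomp Require Import all_classical all_reals all_analysis.
Set Implicit Arguments.
Unset Strict Implicit.
Unset Printing Implicit Defensive.
Import Order.TTheory GRing.Theory Num.Theory.
Import numFieldNormedType.Exports.
Local Open Scope classical_set_scope.
Local Open Scope ring_scope.

(* A Polish space is presented as a complete, Hausdorff and second countable
   pseudometric space (Hausdorff makes the pseudometric a metric); [X] is
   standard Borel when it is isomorphic to the Borel space of a Polish space. *)
Definition standard_borel (R : realType) d (X : measurableType d) : Prop :=
  exists (P : completePseudoMetricType R) (f : X -> P),
    [/\ hausdorff_space P, @second_countable P, bijective f &
        forall A : set X,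
          measurable A <-> exists2 B : set P, <<s open >> B & A = f @^-1` B].

Section Groups.
Variable G : groupType.

Definition is_subgroup (L : set G) : Prop :=
  L 1%g /\ forall g h, L g -> L h -> L (g * h^-1)%g.

Definition left_cosets (L : set G) : set (set G) :=
  [set [set (g * l)%g | l in L] | g in [set: G]].

Lemma left_cosets_mul (L : set G) (g : G) (c : left_cosets L) :
  [set (g * x)%g | x in set_val c] \in left_cosets L.
Proof.
have [h _ hE] := set_valP c; rewrite /set_val/= -hE; apply/mem_set.
exists (g * h)%g => //; apply/seteqP; split=> x /=.
  by move=> [l Ll <-]; exists (h * l)%g; [exists l | rewrite mulgA].
by move=> [_ [l Ll <-] <-]; exists l => //; rewrite mulgA.
Qed.

Definition coset_mul (L : set G) (g : G) (c : left_cosets L) : left_cosets L :=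
  exist (fun c => c \in left_cosets L) _ (left_cosets_mul g c).

End Groups.

Definition bounded_cfun (R : realType) (T : Type) (f : T -> R[i]) : Prop :=
  exists M : R, forall t, Normc.normc (f t) <= M.

(* A mean on l^oo(T): a positive unital linear functional. Only its values on
   bounded functions matter. The order on [R[i]] is the partial order for which
   [0 <= z] means that [z] is real and nonnegative. *)
Definition is_mean (R : realType) (T : Type) (m : (T -> R[i]) -> R[i]) : Prop :=
  [/\ forall (a : R[i]) f g, bounded_cfun f -> bounded_cfun g ->
        m (fun t => a * f t + g t) = a * m f + m g,
      forall f, bounded_cfun f -> (forall t, 0 <= f t) -> 0 <= m f &
      m (fun=> 1) = 1].

Definition coamenable_subgroup (R : realType) (G : groupType) (L : set G) :
    Prop :=
  exists m : (left_cosets L -> R[i]) -> R[i],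
    is_mean m /\
    forall (g : G) f, bounded_cfun f -> m (f \o coset_mul g) = m f.

Section Actions.
Context d (X : measurableType d) (R : realType) (mu : probability X R).
Context (G : groupType) (act : G -> X -> X).

Definition pmp_action : Prop :=
  [/\ forall x, act 1%g x = x,
      forall g h x, act (g * h)%g x = act g (act h x),
      forall g, measurable_fun setT (act g) &
      forall g A, measurable A -> mu (act g @^-1` A) = mu A].

Definition essentially_free : Prop :=
  {ae mu, forall x, forall g, act g x = x -> g = 1%g}.

Definition orbit_rel (L : set G) : set (X * X) :=
  [set p | exists2 g, L g & p.2 = act g p.1].

End Actions.

(* For a relation [S] on [X], the class of [x] is [xsection S x]. A function on
   the quotient R/S is given as a function on [X * set X], of which only the
   values on [quot_rel Q S] are used. *)
Section Coamenability.
Context d (X : measurableType d) (R : realType) (mu : probability X R).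
Implicit Types (Q S : set (X * X)) (xi : X * set X -> R[i]).

Definition full_group Q : set (X -> X) :=
  [set gam : X -> X | [/\ bijective gam, measurable_fun setT gam,
                 forall A, measurable A -> measurable (gam @` A) &
                 {ae mu, forall x, Q (x, gam x)}]].

(* The set of S-classes contained in the Q-class of [x], when S is a
   subrelation of Q. *)
Definition subclasses Q S (x : X) : set (set X) :=
  [set xsection S y | y in xsection Q x].

Definition quot_rel Q S : set (X * set X) := [set p | subclasses Q S p.1 p.2].

Definition quot_borel Q S (E : set (X * set X)) : Prop :=
  E `<=` quot_rel Q S /\
  forall gam, full_group Q gam ->
    measurable [set x | E (x, xsection S (gam x))].

(* The integral of [f >= 0] against the measure mu_{Q/S}; for [f] the indicator
   of [E] the inner sum is the number of [c] with [(x, c)] in [E]. *)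
Definition quot_integral Q S (f : X * set X -> \bar R) : \bar R :=
  (\int[mu]_x \esum_(c in subclasses Q S x) f (x, c))%E.

Definition quot_borel_fun Q S xi : Prop :=
  forall Y : set R, measurable Y ->
    quot_borel Q S (quot_rel Q S `&` [set p | Y (complex.Re (xi p))]) /\
    quot_borel Q S (quot_rel Q S `&` [set p | Y (complex.Im (xi p))]).

Definition quot_L2 Q S xi : Prop :=
  quot_borel_fun Q S xi /\
  (quot_integral Q S (fun p => (Normc.normc (xi p) ^+ 2)%:E) < +oo)%E.

Definition l2norm (T : choiceType) (C : set T) (f : T -> R[i]) : \bar R :=
  sqrte (\esum_(c in C) (Normc.normc (f c) ^+ 2)%:E)%E.

Definition rel_measure Q (E : set (X * X)) : \bar R :=
  (\int[mu]_x counting (xsection (E `&` Q) x))%E.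

(* For [(x, y)] in [Q] the classes of [x] and [y] coincide, so that [xi_x] and
   [xi_y] live on the same set [subclasses Q S x]. *)
Definition coamenable Q S : Prop :=
  exists xi : nat -> X * set X -> R[i],
    [/\ forall n, quot_L2 Q S (xi n),
        forall n, {ae mu, forall x,
          l2norm (subclasses Q S x) (fun c => xi n (x, c)) = 1%E} &
        {ae rel_measure Q, forall p : X * X, Q p ->
          (fun n => l2norm (subclasses Q S p.1)
                      (fun c => xi n (p.1, c) - xi n (p.2, c))) @ \oo
            --> 0%E}].

End Coamenability.

(* The probability space (E, mu(E `&` .) / mu(E)), carried by the subtype of
   points of [E] with the trace sigma-algebra. *)
Definition restr_display (d : measure_display) : measure_display.
Proof. exact: d. Qed.

Section Restriction.
Context d (X : measurableType d) (R : realType) (mu : probability X R).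
Context (E : set X) (mE : measurable E) (E0 : (0 < mu E)%E).

Definition restr_space of measurable E & (0 < mu E)%E : Type := set_type E.

Local Notation XE := (restr_space mE E0).

Definition restr_val (x : XE) : X := set_val x.

Lemma restr_val_in x : E (restr_val x).
Proof. exact: set_valP. Qed.

Lemma restr_val_inj : injective restr_val.
Proof. exact: val_inj. Qed.

Lemma restr_space_nonempty : exists x : XE, True.
Proof.
have [x Ex] : E !=set0.
  by apply/set0P/eqP => e; move: E0; rewrite e measure0 ltxx.
by exists (exist (fun x => x \in E) x (mem_set Ex)).
Qed.

HB.instance Definition _ := Choice.on XE.
HB.instance Definition _ := isPointed.Build XE (sval (cid restr_space_nonempty)).

Definition restr_measurable : set (set XE) :=
  [set restr_val @^-1` B | B in measurable].

Let restr_measurable0 : restr_measurable set0.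
Proof. by exists set0; rewrite ?preimage_set0. Qed.

Let restr_measurableC A : restr_measurable A -> restr_measurable (~` A).
Proof.
by move=> [B mB <-]; exists (~` B); [exact: measurableC|rewrite preimage_setC].
Qed.

Let restr_measurable_bigcup (F : (set XE)^nat) :
  (forall i, restr_measurable (F i)) -> restr_measurable (\bigcup_i F i).
Proof.
move=> mF; have {mF} /choice[B HB] : forall i, exists B,
    measurable B /\ restr_val @^-1` B = F i.
  by move=> i; have [B mB <-] := mF i; exists B.
exists (\bigcup_i B i); first by apply: bigcup_measurable => i _; have [] := HB i.
by rewrite preimage_bigcup; apply: eq_bigcupr => i _; have [] := HB i.
Qed.

HB.instance Definition _ := @isMeasurable.Build (restr_display d) XE
  restr_measurable restr_measurable0 restr_measurableC restr_measurable_bigcup.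

Definition restr_prob (A : set XE) : \bar R :=
  (mu (restr_val @` A) / mu E)%E.

Let image_preimage (B : set X) : restr_val @` (restr_val @^-1` B) = E `&` B.
Proof.
apply/seteqP; split=> [x [y By <-]|x [Ex Bx]].
  by split => //; exact: restr_val_in.
by exists (exist (fun x => x \in E) x (mem_set Ex)).
Qed.

Let measurable_image (A : set XE) :
  measurable A -> measurable (restr_val @` A).
Proof. by move=> [B mB <-]; rewrite image_preimage; exact: measurableI. Qed.

Let restr_prob0 : restr_prob set0 = 0%E.
Proof. by rewrite /restr_prob image_set0 measure0 mul0e. Qed.

Let restr_prob_ge0 A : (0 <= restr_prob A)%E.
Proof. by rewrite /restr_prob mule_ge0// inve_ge0 ltW. Qed.

Let muE_fin : mu E \is a fin_num.
Proof. exact: fin_num_measure. Qed.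

Let restr_prob_sigma_additive : semi_sigma_additive restr_prob.
Proof.
move=> F mF tF mUF; rewrite /restr_prob image_bigcup.
under [X in X @ _]eq_fun do rewrite -ge0_sume_distrl//.
have iE : (mu E)^-1%E \is a fin_num.
  by rewrite -(fineK muE_fin) inver fine_eq0 ?muE_fin// gt_eqF.
apply: cvgeZr => //.
apply: measure_semi_sigma_additive.
- by move=> i; exact: measurable_image.
- apply/trivIsetP => i j _ _ ij.
  move/trivIsetP : tF => /(_ i j I I ij) Fij.
  apply/seteqP; split=> // x [[y Fy yx] [z Fz zx]].
  have yz : y = z by apply: restr_val_inj; rewrite yx zx.
  have : (F i `&` F j) y by split => //; rewrite yz.
  by rewrite Fij.
- by apply: bigcup_measurable => i _; exact: measurable_image.
Qed.

HB.instance Definition _ := isMeasure.Build _ _ _ restr_prob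
  restr_prob0 restr_prob_ge0 restr_prob_sigma_additive.

Let restr_prob1 : restr_prob setT = 1%E.
Proof.
rewrite /restr_prob -(preimage_setT restr_val) image_preimage setIT.
by rewrite divee// gt_eqF.
Qed.

HB.instance Definition _ :=
  Measure_isProbability.Build _ _ _ restr_prob restr_prob1.

Definition restr_rel (Q : set (X * X)) : set (XE * XE) :=
  [set p | Q (restr_val p.1, restr_val p.2)].

End Restriction.
Arguments restr_prob {d X R mu E} mE E0 A.
Arguments restr_rel {d X R mu E} mE E0 Q.

Definition coamenable_on d (X : measurableType d) (R : realType)
    (mu : probability X R) (E : set X) (mE : measurable E)
    (E0 : (0 < mu E)%E) (Q S : set (X * X)) : Prop :=
  coamenable (restr_prob mE E0) (restr_rel mE E0 Q) (restr_rel mE E0 S).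

Definition everywhere_coamenable d (X : measurableType d) (R : realType)
    (mu : probability X R) (Q S : set (X * X)) : Prop :=
  forall (E : set X) (mE : measurable E) (E0 : (0 < mu E)%E),
    coamenable_on mE E0 Q S.

(* Main.v *)
From HB Require Import structures.
Require Import Defs.
From mathcomp Require Import all_boot all_order all_algebra.
From mathcomp Require Import complex finmap.
From mathcomp Require Import all_classical all_reals all_analysis.
From mathcomp Require Import measurable_realfun.
From mathcomp Require Import ring lra.
Set Implicit Arguments.
Unset Strict Implicit.
Unset Printing Implicit Defensive.
Import Order.TTheory GRing.Theory Num.Theory.
Import numFieldNormedType.Exports.
Local Open Scope classical_set_scope.
Local Open Scope ring_scope.

                                  

(** Both parts pass through Reiter's form of coamenability: nonnegative unit vectors p_n in l^1(G/L)
    with ||p_n(g .) - p_n||_1 tending to 0 for every g. An ultralimit of averages against such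
    vectors is an invariant mean ([coamenable_of_reiter]). Conversely, Day's separation argument
    ([day], resting on [hahn_banach]) extracts them from a mean, and countability of the group makes
    the error for g at most 2^-n for all large n ([reiter_of_coamenable]). The link with the
    relations is [coset_class]: a coset gL is sent to the L-orbit of g^-1 x, traced on E. Replacing
    x and a by hx and ha does not change this class, and every S-class in the orbit of x arises so.

    For (i), one would push p_n forward along [coset_class x], normalise and take square roots. But
    p_n may give very little mass to the cosets whose class meets E, and normalising then destroys
    the invariance. The remedy is to sum p_n over long windows N <= n < M N. Since the errors are
    summable, the windows become more invariant as N grows, and the set of points with finite total
    mass is invariant under the group. On that set the masses tend to 0, while their integrals are
    constant in n and bound the measure of its intersection with E; hence this intersection is null
    ([transient_null]). Borel-Cantelli gives window ends for which a.e. point of E eventually has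
    window mass at least 1 ([coamenable_of_windows]), and the inequality (sqrt s - sqrt t)^2 <= |s -
    t| turns l^1 into l^2 invariance ([coamenable_of_mass]).

    For (ii), let xi be almost invariant for the relation on E. Each x in the saturation of E is
    moved into E by the first group element that does so, which gives [base x]. By freeness
    [coset_class x] is injective on cosets with nonempty class, so |xi_n|^2 at [base x] is a
    probability weight on G/L. The weights at x and kx agree up to translation by k and an error
    tending to 0. Integrating over x absorbs the move from x to kx, because mu is invariant, and
    yields a Reiter sequence ([coamenable_of_almost_invariant]). *)

(** * Sums of nonnegative extended reals, and their exchange with integrals *)

Section Esum.
Context {R : realType} {T : choiceType}.
Local Open Scope ereal_scope.
Implicit Types (A : set T) (f g : T -> \bar R).

Lemma esum_ge1 A f a : A a -> (forall i, A i -> 0 <= f i) ->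
  f a <= \esum_(i in A) f i.
Proof.
move=> Aa f0; apply: esum_ge; exists [set a]; last by rewrite fsbig_set1.
by split=> // _ ->.
Qed.

Lemma esumZl A f (r : R) : (0 <= r)%R -> (forall i, 0 <= f i) ->
  \esum_(i in A) (r%:E * f i) = r%:E * \esum_(i in A) f i.
Proof.
have le (s : R) g : (0 <= s)%R -> (forall i, 0 <= g i) ->
    \esum_(i in A) (s%:E * g i) <= s%:E * \esum_(i in A) g i.
  move=> s0 g0; apply: ge_ereal_sup => _ [X [finX XA] <-].
  rewrite -ge0_mule_fsumr// lee_wpmul2l ?lee_fin//.
  by apply: esum_ge; exists X.
move=> r0 f0; apply/eqP; rewrite eq_le le//=.
have [->|rn0] := eqVneq r 0%R.
  by rewrite mul0e esum_ge0// => i Ai; rewrite mul0e.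
have rp : (0 < r)%R by rewrite lt_neqAle eq_sym rn0.
rewrite -lee_pdivlMl//; apply: le_trans (le _ _ _ _).
- by apply: le_esum => i Ai; rewrite muleA -EFinM mulVf// mul1e.
- by rewrite invr_ge0.
- by move=> i; rewrite mule_ge0.
Qed.

End Esum.

Section EsumCountable.
Context {R : realType} {T : choiceType} (cT : countable [set: T]).
Local Open Scope ereal_scope.

(** [F n] is the fibre over [n] of an injection into the naturals, hence empty or a singleton. One
    family [F] serves all summands, so a sum depending on a parameter becomes a series of
    functions. *)
Lemma esum_nneseries : exists F : nat -> set T,
  (forall n, F n = set0 \/ exists a, F n = [set a]) /\
  (forall f : T -> \bar R, (forall a, 0 <= f a) ->
     \esum_(a in setT) f a = \sum_(0 <= n <oo) \esum_(a in F n) f a).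
Proof.
have /countable_injP[h /in2TT hinj] := cT.
exists (fun n => h @^-1` [set n]); split.
  move=> n; have [->|/set0P[a ha]] := eqVneq (h @^-1` [set n]) set0; first by left.
  right; exists a; apply/seteqP; split=> [b /= hb|_ ->//].
  by apply: hinj => //; rewrite hb ha.
move=> f f0; rewrite -nneseries_sum_bigcup//.
  by congr esum; apply/seteqP; split=> // a _; exists (h a).
by apply/trivIsetP => i j _ _ ij; apply/seteqP; split=> // a [/= -> /eqP]; rewrite (negbTE ij).
Qed.

Context {d} {X : measurableType d}.

Lemma measurable_esum (D : set X) (f : T -> X -> \bar R) : (forall a x, 0 <= f a x) ->
  (forall a, measurable_fun D (f a)) ->
  measurable_fun D (fun x => \esum_(a in setT) f a x).
Proof.
move=> f0 mf; have [F [F1 FE]] := esum_nneseries.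
under eq_fun do rewrite FE//.
apply: (@ge0_emeasurable_sum _ _ R D (fun n x => \esum_(a in F n) f a x) xpredT).
  by move=> n x _ _; exact: esum_ge0.
move=> n _.
have [->|[a ->]] := F1 n.
  by under eq_fun do rewrite esum_set0; exact: measurable_cst.
by under eq_fun do rewrite esum_set1//; exact: mf.
Qed.

Lemma integral_esum (mu : {measure set X -> \bar R}) (D : set X) (f : T -> X -> \bar R) :
  measurable D -> (forall a x, 0 <= f a x) ->
  (forall a, measurable_fun D (f a)) ->
  \int[mu]_(x in D) (\esum_(a in setT) f a x) = \esum_(a in setT) (\int[mu]_(x in D) f a x).
Proof.
move=> mD f0 mf; have [F [F1 FE]] := esum_nneseries.
under eq_integral do rewrite FE//.
rewrite FE; last by move=> a; exact: integral_ge0.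
rewrite integral_nneseries//.
- apply: eq_eseriesr => n _; have [->|[a ->]] := F1 n.
    by under eq_integral do rewrite esum_set0; rewrite integral0 esum_set0.
  rewrite esum_set1; last exact: integral_ge0.
  by under eq_integral do rewrite esum_set1//.
- move=> n; have [->|[a ->]] := F1 n.
    by under eq_fun do rewrite esum_set0; exact: measurable_cst.
  by under eq_fun do rewrite esum_set1//; exact: mf.
- by move=> n x _; exact: esum_ge0.
Qed.

End EsumCountable.

                               

(** * Hahn-Banach and cone separation over an abelian group *)

Section HahnBanach.
Context {R : realType} {V : zmodType}.
Implicit Types (p q : V -> R) (u v : V).

(** On an abelian group homogeneity can only be asked for natural multiples. The third clause
    supplies the inequality that does not follow from subadditivity; at [n = 0] it gives
    [0 <= p 0]. *)
Definition sublinear p : Prop :=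
  [/\ forall u v, p (u + v) <= p u + p v, p 0 <= 0 &
      forall n v, p v *+ n <= p (v *+ n)].

Lemma sublinear_oppr p u : sublinear p -> - p (- u) <= p u.
Proof.
move=> [pD _ pn]; have := pD u (- u); rewrite subrr => p0.
have := pn 0%N 0; rewrite mulr0n mul0rn; lra.
Qed.

(** Directedness preserves subadditivity: members good for [u] and for [v] have a common lower bound
    good for both. The infimum is finite because [p v >= - p (- v) >= - q (- v)]. *)
Lemma sublinear_inf (P : set (V -> R)) (q : V -> R) : P !=set0 ->
  (forall p, P p -> sublinear p) ->
  (forall p, P p -> forall v, p v <= q v) ->
  (forall p p', P p -> P p' -> exists2 p'', P p'' &
     forall v, p'' v <= p v /\ p'' v <= p' v) ->
  let r v := inf [set p v | p in P] in
  sublinear r /\ forall p, P p -> forall v, r v <= p v.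
Proof.
move=> [p1 Pp1] Psub Pq Pdir r.
have rle p : P p -> forall v, r v <= p v.
  move=> Pp v; apply: ge_inf; last by exists p.
  exists (- q (- v)) => _ [p' Pp' <-].
  by apply: le_trans (sublinear_oppr _ (Psub _ Pp')); rewrite lerN2 Pq.
have ler v x : (forall p, P p -> x <= p v) -> x <= r v.
  move=> xle; apply: lb_le_inf; first by exists (p1 v); exists p1.
  by move=> _ [p Pp <-]; exact: xle.
split=> //; split.
- move=> u v; rewrite -lerBlDr; apply: (ler) => p Pp.
  rewrite lerBlDr -lerBlDl; apply: (ler) => p' Pp'; rewrite lerBlDl.
  have [p'' Pp'' ple] := Pdir _ _ Pp Pp'.
  apply: le_trans (rle _ Pp'' _) _; have [+ _ _] := Psub _ Pp'' => /(_ u v)/le_trans; apply.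
  by apply: lerD; [have [] := ple u|have [] := ple v].
- by apply: le_trans (rle _ Pp1 _) _; have [] := Psub _ Pp1.
- move=> n v; apply: (ler) => p Pp; have [_ _ +] := Psub _ Pp => /(_ n v).
  by apply: le_trans; rewrite lerMn2r (rle _ Pp) orbT.
Qed.

                                                                               
                                                                                
(** Zorn gives a minimal sublinear functional [p] below [q], and minimality forces additivity: the
    infimum over n of [p (x + v *+ n) - p v *+ n] is again sublinear and below [p], hence equal to
    it, and its term n = 1 is the missing superadditivity. *)
Lemma hahn_banach q : sublinear q ->
  exists2 phi : V -> R, {morph phi : u v / u + v} & forall v, phi v <= q v.
Proof.
move=> qsub; pose S := {p : V -> R | sublinear p /\ forall v, p v <= q v}.
(* The order is reversed, so that a maximal element for Zorn is a pointwise minimal functional. *)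
pose rel (p p' : S) := `[< forall v, sval p' v <= sval p v >].
have [|||[p [psub pq]] pmin] := @ZL_preorder S (exist _ q (conj qsub (fun=> lexx _))) rel.
- by move=> p; apply/asboolP.
- move=> p p' p'' /asboolP h /asboolP k; apply/asboolP => v.
  exact: le_trans (k v) (h v).
- move=> A Atot; have [->|/set0P[[p0 [p0sub p0q]] Ap0]] := eqVneq A set0.
    by exists (exist _ q (conj qsub (fun=> lexx _))).
  have [||||rsub rle] := @sublinear_inf [set sval p | p in A] q.
  + by exists p0; exists (exist _ p0 (conj p0sub p0q)).
  + by move=> _ [[p [? ?]] _ <-].
  + by move=> _ [[p [? ?]] _ <-].
  + move=> _ _ [p Ap <-] [p' Ap' <-].
    have [/asboolP h|/asboolP h] := Atot _ _ Ap Ap'.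
      by exists (sval p') => //; exists p'.
    by exists (sval p) => //; exists p.
  set r := (fun v => _) in rsub rle.
  have rq v : r v <= q v.
    apply: le_trans (p0q v); apply: rle.
    by exists (exist _ p0 (conj p0sub p0q)).
  exists (exist _ r (conj rsub rq) : S).
  move=> p Ap; apply/asboolP => v /=; apply: rle; by exists p.
exists p => //; move=> u v; apply/eqP; rewrite eq_le; apply/andP; split.
  by have [->] := psub.
(* [pv n] decreases with [n] by subadditivity; its infimum [r] is the competitor to which minimality
   of [p] is applied. *)
pose pv n x := p (x + v *+ n) - p v *+ n.
have [pD p0 pn] := psub.
have pvS m n : (m <= n)%N -> forall x, pv n x <= pv m x.
  move=> /subnK <- x; rewrite /pv; elim: (n - m)%N => [//|k]; apply: le_trans.
  rewrite addSn !mulrSr addrA; have := pD (x + v *+ (k + m)) v; lra.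
have pvD n x y : pv (n + n)%N (x + y) <= pv n x + pv n y.
  rewrite /pv !mulrnDr addrACA; have := pD (x + v *+ n) (y + v *+ n); lra.
pose r x := inf [set pv n x | n in setT].
have lbr x : has_lbound [set pv n x | n in setT].
  exists (- p (- x)) => _ [n _ <-]; rewrite /pv.
  have := pD (x + v *+ n) (- x); rewrite addrC addKr; have := pn n v; lra.
have rle n x : r x <= pv n x by apply: ge_inf => //; exists n.
have ler x y : (forall n, y <= pv n x) -> y <= r x.
  move=> yle; apply: lb_le_inf; first by exists (pv 0%N x); exists 0%N.
  by move=> _ [n _ <-].
have rp x : r x <= p x.
  by apply: le_trans (rle 0%N x) _; rewrite /pv !mulr0n addr0 subr0.
have rsub : sublinear r.
  split.
  - move=> x y; rewrite -lerBlDr; apply: (ler) => n.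
    rewrite lerBlDr -lerBlDl; apply: (ler) => m; rewrite lerBlDl.
    apply: le_trans (rle (maxn n m + maxn n m)%N _) _.
    apply: le_trans (pvD _ _ _) _.
    by apply: lerD; apply: pvS; rewrite ?leq_maxl ?leq_maxr.
  - exact: le_trans (rp 0) p0.
  - move=> n x; apply: (ler) => m.
    have [->|n0] := posnP n.
      rewrite !mulr0n /pv add0r subr_ge0; exact: pn.
    apply: (@le_trans _ _ (pv m x *+ n)); first by rewrite lerMn2r rle orbT.
    apply: (@le_trans _ _ (pv (m * n)%N (x *+ n))); last by apply: pvS; rewrite leq_pmulr.
    by rewrite /pv !mulrnA -mulrnDl mulrnBl lerB// pn.
have /asboolP/= pr : rel (exist _ r (conj rsub (fun x => le_trans (rp x) (pq x))) : S)
    (exist _ p (conj psub pq) : S).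
  by apply: pmin; apply/asboolP.
have := le_trans (pr u) (rle 1%N u); rewrite /pv !mulr1n; lra.
Qed.

(** Hahn-Banach is applied to the infimum of [N (v + c.1) - c.2] over [C]; evaluating the resulting
    functional at [- c.1] gives the lower bound on the cone. Divisibility of [C] replaces stability
    under positive scalars. *)
Lemma cone_separation (N : V -> R) (C : set (V * R)) :
  sublinear N -> C (0, 0) -> (forall c c', C c -> C c' -> C (c + c')) ->
  (forall c n, C c -> (0 < n)%N -> exists2 c', C c' & c = c' *+ n) ->
  (forall c, C c -> c.2 <= N c.1) ->
  exists phi : V -> R, [/\ {morph phi : u v / u + v},
    forall v, phi v <= N v & forall c, C c -> c.2 <= phi c.1].
Proof.
move=> [ND N0 Nn] C0 CD Cdiv CN.
pose q v := inf [set N (v + c.1) - c.2 | c in C].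
have lbq v : has_lbound [set N (v + c.1) - c.2 | c in C].
  exists (- N (- v)) => _ [c Cc <-].
  have := ND (v + c.1) (- v); rewrite addrC addKr; have := CN _ Cc; lra.
have qle c v : C c -> q v <= N (v + c.1) - c.2.
  by move=> Cc; apply: ge_inf => //; exists c.
have leq v x : (forall c, C c -> x <= N (v + c.1) - c.2) -> x <= q v.
  move=> xle; apply: lb_le_inf; first by exists (N (v + 0) - 0), (0, 0).
  by move=> _ [c Cc <-]; exact: xle.
have qN v : q v <= N v.
  by apply: le_trans (qle (0, 0) v C0) _; rewrite /= addr0 subr0.
have [|phi phiD phiq] := @hahn_banach q.
  split.
  - move=> u v; rewrite -lerBlDr; apply: (leq) => c Cc.
    rewrite lerBlDr -lerBlDl; apply: (leq) => c' Cc'; rewrite lerBlDl.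
    apply: le_trans (qle _ _ (CD _ _ Cc Cc')) _; rewrite addrACA /=.
    have := ND (u + c.1) (v + c'.1); lra.
  - exact: le_trans (qN 0) N0.
  - move=> n v; apply: (leq) => c Cc; have [->|n0] := posnP n.
      by rewrite !mulr0n add0r subr_ge0 CN.
    have [c' Cc' ->] := Cdiv _ _ Cc n0.
    apply: (@le_trans _ _ ((N (v + c'.1) - c'.2) *+ n)).
      by rewrite lerMn2r qle// orbT.
    by rewrite !raddfMn /= -mulrnDl mulrnBl mulNrn lerB.
exists phi; split=> // [v|c Cc]; first exact: le_trans (phiq v) (qN v).
have phi0 : phi 0 = 0 by have := phiD 0 0; rewrite addr0; lra.
have := phiD c.1 (- c.1); rewrite subrr phi0.
have := le_trans (phiq (- c.1)) (qle _ (- c.1) Cc); rewrite addNr; lra.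
Qed.

End HahnBanach.

(** * The group of absolutely summable functions *)

Section L1.
Context {R : realType} {J : choiceType}.
Implicit Types v w : J -> R.

Definition l1norm v : \bar R := (\esum_(j in [set: J]) `|v j|%:E)%E.

Lemma l1norm_ge0 v : (0 <= l1norm v)%E.
Proof. by apply: esum_ge0 => j _; rewrite lee_fin. Qed.

Lemma le_l1norm v w : (forall j, `|v j| <= `|w j|) -> (l1norm v <= l1norm w)%E.
Proof. by move=> vw; apply: le_esum => j _; rewrite lee_fin. Qed.

Lemma l1normD v w : (l1norm (v \+ w)%R <= l1norm v + l1norm w)%E.
Proof.
rewrite -esumD; do ?by move=> j _; rewrite lee_fin.
by apply: le_esum => j _; rewrite -EFinD lee_fin ler_normD.
Qed.

Lemma l1norm0 : l1norm (fun=> 0) = 0%E.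
Proof. by apply: esum1 => j _; rewrite normr0. Qed.

Lemma l1normZ (r : R) v : l1norm (fun j => r * v j) = (`|r|%:E * l1norm v)%E.
Proof.
rewrite -esumZl//.
by apply: eq_esum => j _; rewrite normrM EFinM.
Qed.

Definition summable_pred : {pred J -> R} := fun v => (l1norm v < +oo)%E.

Lemma summable_zmod_closed : zmod_closed summable_pred.
Proof.
split=> [|v w]; rewrite /summable_pred !unfold_in.
  by rewrite (_ : 0 = fun=> 0)// l1norm0 ltry.
move=> lv lw; apply: le_lt_trans (l1normD v (fun j => - w j)) _.
rewrite lte_add_pinfty//; apply: le_lt_trans lw.
by apply: le_l1norm => j; rewrite normrN.
Qed.

HB.instance Definition _ :=
  GRing.isZmodClosed.Build (J -> R) summable_pred summable_zmod_closed.

(** Only the additive structure is put on [l1], as [hahn_banach] asks for an abelian group. *)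
Record l1 := L1 { l1val :> J -> R; _ : l1val \in summable_pred }.
HB.instance Definition _ := [isSub for l1val].
HB.instance Definition _ := [Choice of l1 by <:].
HB.instance Definition _ := [SubChoice_isSubZmodule of l1 by <:].

Definition l1nrm (v : l1) : R := fine (l1norm v).

Lemma l1nrmE (v : l1) : (l1nrm v)%:E = l1norm v.
Proof.
rewrite fineK// ge0_fin_numE ?l1norm_ge0//; exact: (valP v).
Qed.

Lemma l1valD (v w : l1) j : (v + w) j = v j + w j.
Proof. by []. Qed.

Lemma l1valMn (v : l1) n j : (v *+ n) j = v j *+ n.
Proof. by elim: n => [|n ih]; rewrite ?mulr0n// !mulrS l1valD ih. Qed.

Lemma l1nrm_sublinear : sublinear l1nrm.
Proof.
split=> [v w||n v].
- by rewrite -lee_fin EFinD !l1nrmE l1normD.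
- by rewrite -lee_fin l1nrmE (_ : l1val 0 = fun=> 0)// l1norm0.
- rewrite -lee_fin -mulr_natl EFinM !l1nrmE -(ger0_norm (ler0n R n)) -l1normZ.
  by apply: le_l1norm => j; rewrite l1valMn mulr_natl.
Qed.

End L1.
Arguments l1 : clear implicits.

                                                           

(** * Complex means evaluated on real functions *)

Section RealMean.
Local Open Scope complex_scope.
Context {R : realType}.

Lemma normc_real (x : R) : Normc.normc x%:C = `|x|.
Proof. by rewrite /= expr0n addr0 sqrtr_sqr. Qed.

Context {T : Type} (m : (T -> R[i]) -> R[i]) (mm : is_mean m).
Implicit Types f g : T -> R.

Definition bounded_rfun f := exists M, forall t, `|f t| <= M.

Lemma bounded_rfunC f : bounded_rfun f -> bounded_cfun (fun t => (f t)%:C).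
Proof. by move=> [M fM]; exists M => t; rewrite normc_real. Qed.

Lemma bounded_rfunD f g : bounded_rfun f -> bounded_rfun g ->
  bounded_rfun (fun t => f t + g t).
Proof.
move=> [M fM] [N gN]; exists (M + N) => t.
by apply: le_trans (ler_normD _ _) _; exact: lerD.
Qed.

Lemma bounded_rfunN f : bounded_rfun f -> bounded_rfun (fun t => - f t).
Proof. by move=> [M fM]; exists M => t; rewrite normrN. Qed.

Definition rmean f := m (fun t => (f t)%:C).

Lemma rmeanD f g : bounded_rfun f -> bounded_rfun g ->
  rmean (fun t => f t + g t) = rmean f + rmean g.
Proof.
move=> bf bg; have [mD _ _] := mm.
have := mD 1 _ _ (bounded_rfunC bf) (bounded_rfunC bg); rewrite mul1r => <-.
by congr m; apply/funext => t; rewrite mul1r rmorphD.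
Qed.

Lemma rmean_cst (r : R) : rmean (fun=> r) = r%:C.
Proof.
have [mD _ m1] := mm.
have b1 (x : R) : bounded_cfun (fun _ : T => x%:C).
  by exists `|x| => t; rewrite normc_real.
have m0 : m (fun=> 0%:C) = 0.
  have := mD 1 _ _ (b1 0) (b1 0).
  rewrite (_ : (fun _ => _) = fun=> 0%:C); last first.
    by apply/funext => t; rewrite mul1r addr0.
  by rewrite mul1r => /eqP; rewrite -subr_eq0 opprD addrA subrr sub0r oppr_eq0 => /eqP.
have := mD r%:C _ _ (b1 1) (b1 0); rewrite m1 m0 mulr1 addr0 => <-.
by congr m; apply/funext => t; rewrite mulr1 addr0.
Qed.

Lemma rmeanN f : bounded_rfun f -> rmean (fun t => - f t) = - rmean f.
Proof.
move=> bf; apply/eqP; rewrite -addr_eq0 -rmeanD ?(bounded_rfunN bf)//; last exact: bounded_rfunN.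
by under [X in rmean X]eq_fun do rewrite addNr; rewrite rmean_cst.
Qed.

Lemma rmean_sum (I : Type) (s : seq I) (f : I -> T -> R) :
  (forall i, bounded_rfun (f i)) ->
  bounded_rfun (fun t => \sum_(i <- s) f i t) /\
  rmean (fun t => \sum_(i <- s) f i t) = \sum_(i <- s) rmean (f i).
Proof.
move=> bf; elim: s => [|i s [bs es]].
  split; first by exists 0 => t; rewrite big_nil normr0.
  rewrite big_nil; transitivity (rmean (fun=> 0)); last exact: rmean_cst.
  by congr rmean; apply/funext => t; rewrite big_nil.
split.
  have [M HM] := bounded_rfunD (bf i) bs.
  by exists M => t; rewrite big_cons; exact: HM.
rewrite big_cons -es -rmeanD//; congr rmean; apply/funext => t.
by rewrite big_cons.
Qed.

Lemma rmean_ge f (r : R) : bounded_rfun f -> (forall t, r <= f t) ->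
  r%:C <= rmean f.
Proof.
move=> bf fr; have br : bounded_rfun (fun _ : T => r) by exists `|r|.
rewrite -subr_ge0 -rmean_cst -rmeanN// -rmeanD//; last exact: bounded_rfunN.
have [_ mpos _] := mm; apply: mpos => [|t].
  by apply: bounded_rfunC; apply: bounded_rfunD => //; exact: bounded_rfunN.
by rewrite ler0c subr_ge0.
Qed.

End RealMean.

(** * Day's argument: from an invariant mean to almost invariant vectors *)

Section Day.
Local Open Scope complex_scope.
Context {R : realType} {T : choiceType} {k : nat}.
Context (s t : 'I_k -> T -> T).
Context (st : forall i, cancel (s i) (t i)) (ts : forall i, cancel (t i) (s i)).
Local Notation J := ('I_k * T)%type.

Definition displacement (w : T -> R) : J -> R := fun j => w (s j.1 j.2) - w j.2.

Lemma l1norm_displacement (w : T -> R) :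
  l1norm (displacement w) =
  (\sum_(i < k) l1norm (fun a => w (s i a) - w a)%R)%E.
Proof.
rewrite /l1norm.
have := @esum_esum R 'I_k T setT (fun=> setT) (fun i a => `|w (s i a) - w a|%:E).
rewrite (_ : [set: 'I_k] `*`` (fun=> [set: T]) = setT); last first.
  by apply/seteqP; split.
move=> <-; last by move=> *; rewrite lee_fin.
rewrite esum_fset//; last 2 first.
- exact: finite_finset.
- by move=> i _; apply: esum_ge0 => *; rewrite lee_fin.
rewrite (@fsbigE _ _ _ _ _ (index_enum 'I_k)) ?index_enum_uniq//; last first.
  by move=> i _; rewrite mem_index_enum.
by apply: eq_bigl => i; rewrite in_setT.
Qed.

Lemma l1norm_comp (w : T -> R) i : l1norm (w \o s i) = l1norm w.
Proof.
rewrite /l1norm [RHS](@reindex_esum _ _ _ setT setT (s i))//.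
split=> // [a b _ _|a _]; first exact: (can_inj (st i)).
by exists (t i a) => //; exact: ts.
Qed.

Lemma l1norm_delta {I : choiceType} (i : I) :
  l1norm (fun j : I => (j == i)%:R : R) = 1%E.
Proof.
rewrite /l1norm -(@esum_set1 R I i (fun=> 1%E))// [RHS]esum_mkcond.
apply: eq_esum => j _; have [->|ji] := eqVneq j i; first by rewrite normr1 mem_set.
by rewrite normr0 memNset//; exact/eqP.
Qed.

Lemma summable_delta {I : choiceType} (i : I) :
  (fun j : I => (j == i)%:R : R) \in summable_pred.
Proof. by rewrite unfold_in l1norm_delta ltry. Qed.

Definition l1delta {I : choiceType} (i : I) : l1 R I := L1 (summable_delta i).

                                                                                  
                                                            
                                                                               
                  
(** If no such [p] exists, displacement expands the l^1 norm of nonnegative functions by a factor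
    [e]. Separation then produces bounded functions [f i] for which the sum of [f i \o t i - f i] is
    at least [e] everywhere, although an invariant mean of it is 0. *)
Lemma day (m : (T -> R[i]) -> R[i]) (e : R) : is_mean m ->
  (forall i f, bounded_cfun f -> m (f \o t i) = m f) -> 0 < e ->
  exists p : T -> R, [/\ forall a, 0 <= p a, l1norm p = 1%E &
    forall i, (l1norm (fun a => p (s i a) - p a)%R <= e%:E)%E].
Proof.
move=> mm minv e0; apply: contrapT => noinv.
(* Normalising [w] would give a forbidden [p] if its total displacement were smaller than [e] times
   its norm. *)
have expand (w : T -> R) : (forall a, 0 <= w a) -> (l1norm w < +oo)%E ->
    (e%:E * l1norm w <= l1norm (displacement w))%E.
  move=> w0 lw; have lwf : l1norm w \is a fin_num.
    by rewrite ge0_fin_numE// l1norm_ge0.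
  have [->|wn0] := eqVneq (l1norm w) 0%E; first by rewrite mule0 l1norm_ge0.
  pose r := fine (l1norm w).
  have rE : l1norm w = r%:E by rewrite fineK.
  have r0 : 0 < r.
    by rewrite -lte_fin -rE lt_neqAle eq_sym wn0 l1norm_ge0.
  have ri0 : 0 <= r^-1 by rewrite invr_ge0 ltW.
  apply: contrapT => /negP; rewrite -ltNge => lte.
  apply: noinv; exists (fun a => r^-1 * w a); split.
  - by move=> a; rewrite mulr_ge0.
  - by rewrite l1normZ rE (ger0_norm ri0) -EFinM mulVf// gt_eqF.
  - move=> i; rewrite (_ : (fun _ => _) = fun a => r^-1 * (w (s i a) - w a)); last first.
      by apply/funext => a; rewrite mulrBr.
    rewrite l1normZ (ger0_norm ri0) lee_pdivrMl// muleC -rE.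
    apply: le_trans (ltW lte); rewrite l1norm_displacement (bigD1 i)//=.
    by rewrite leeDl// sume_ge0// => j _; exact: l1norm_ge0.
(* The cone of pairs (displacement of [w], [e] times the norm of [w]) with [w >= 0]; [expand] says
   that it lies below the norm. *)
pose C := [set c : (l1 R J * R)%type | exists w : T -> R,
  [/\ forall a, 0 <= w a, (l1norm w)%E = (c.2 / e)%:E &
      forall j, c.1 j = displacement w j]].
have [||||phi [phiD phiN phiC]] := cone_separation (C := C) l1nrm_sublinear.
- by exists (fun=> 0); split=> // [|j]; rewrite ?l1norm0 ?mul0r// /displacement subrr.
- move=> [v r] [v' r'] [w [w0 wr wv]] [w' [w'0 wr' wv']] /=.
  exists (w \+ w')%R; split=> [a||j]; first exact: addr_ge0.
  + rewrite /= mulrDl EFinD -wr -wr' -esumD; do ?by move=> j _; rewrite lee_fin.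
    by apply: eq_esum => a _; rewrite -EFinD !ger0_norm ?addr_ge0.
  + by rewrite [LHS](_ : _ = v j + v' j)// [v j]wv [v' j]wv' /displacement /= opprD addrACA.
- move=> [v r] n [w [w0 /= wr wv]] n0.
  have nn0 : n%:R != 0 :> R by rewrite pnatr_eq0 -lt0n.
  have sv : (fun j => n%:R^-1 * v j) \in summable_pred.
    rewrite unfold_in l1normZ; apply: lte_mul_pinfty => //.
    by rewrite -l1nrmE ltry.
  exists (L1 sv, n%:R^-1 * r).
    exists (fun a => n%:R^-1 * w a); split=> [a||j].
    + by rewrite mulr_ge0// invr_ge0.
    + by rewrite l1normZ wr ger0_norm ?invr_ge0// -EFinM mulrA.
    + by rewrite /= wv /displacement mulrBr.
  apply: injective_projections; rewrite raddfMn/=; last first.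
    by rewrite -[RHS]mulr_natl mulrA divff// mul1r.
  apply/val_inj/funext => j /=.
  by rewrite l1valMn /= -[RHS]mulr_natl mulrA divff// mul1r.
- move=> [v r] [w [w0 /= wr wv]].
  have vE : l1norm v = l1norm (displacement w).
    by rewrite /l1norm; apply: eq_esum => j _; rewrite wv.
  have := expand w w0; rewrite wr ltry -vE -l1nrmE => /(_ isT).
  by rewrite -EFinM mulrC divfK ?lee_fin// gt_eqF.
have phi0 : phi 0 = 0 by have := phiD 0 0; rewrite addr0; lra.
have phiB u v : phi (u - v) = phi u - phi v.
  by have := phiD (u - v) v; rewrite subrK; lra.
have phi_sum (I : Type) (r : seq I) (F : I -> l1 R J) :
    phi (\sum_(i <- r) F i) = \sum_(i <- r) phi (F i).
  by elim: r => [|i r ih]; rewrite ?big_nil// !big_cons phiD ih.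
pose f i a := phi (l1delta (i, a)).
have fb i : bounded_rfun (f i).
  have ld j : l1nrm (l1delta j : l1 R J) = 1 by rewrite /l1nrm l1norm_delta.
  have ldN j : l1nrm (- l1delta j : l1 R J) = 1.
    by rewrite -(ld j); congr fine; apply: eq_esum => ? _ /=; rewrite normrN.
  exists 1 => a; rewrite ler_norml; apply/andP; split.
    rewrite lerNl -(ldN (i, a)); apply: le_trans (phiN _).
    by rewrite -[X in _ <= phi X]sub0r phiB phi0 sub0r.
  by apply: le_trans (phiN _) _; rewrite ld.
have fbt i : bounded_rfun (f i \o t i).
  by have [M fM] := fb i; exists M => a; exact: fM.
pose F a := \sum_(i < k) (f i (t i a) - f i a).
have Fe a : e <= F a.
  (* [v] is the displacement of the Dirac mass at [a], which has norm 1, so the cone inequality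
     gives [phi v >= e]. *)
  pose v : l1 R J := \sum_(i < k) (l1delta (i, t i a) - l1delta (i, a)).
  have -> : F a = phi v by rewrite phi_sum; apply: eq_bigr => i _; rewrite phiB.
  apply: (phiC (v, e)); exists (fun b => (b == a)%:R); split=> //.
    by rewrite l1norm_delta divff// gt_eqF.
  move=> [i b]; rewrite /displacement /=.
  have -> : v (i, b) = \sum_(i0 < k) (((i, b) == (i0, t i0 a))%:R - ((i, b) == (i0, a))%:R).
    apply: (big_ind2 (fun (u : l1 R J) x => u (i, b) = x)) => // u x u' x' <- <-.
    exact: l1valD.
  rewrite (bigD1 i)//= big1 => [|i' i'i]; rewrite !xpair_eqE.
    by rewrite eqxx addr0 (can2_eq (st i) (ts i)).
  by rewrite eq_sym (negbTE i'i) subrr.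
have [Fb FE] := rmean_sum mm (index_enum 'I_k) (f := fun i a => f i (t i a) - f i a)
  (fun i => bounded_rfunD (fbt i) (bounded_rfunN (fb i))).
have := rmean_ge mm Fb Fe.
rewrite [X in _ <= X]FE big1 => [|i _].
  by rewrite lecR leNgt e0.
rewrite rmeanD ?rmeanN//; [|exact: fbt|exact: bounded_rfunN].
rewrite [X in X + _](_ : _ = rmean m (f i)) ?subrr//.
exact: (minv i (fun a => (f i a)%:C) (bounded_rfunC (fb i))).
Qed.

End Day.

                                                           

(** * The mean obtained as an ultralimit of weighted averages *)

Section LimitMean.
Local Open Scope complex_scope.
Context {R : realType} {T : choiceType} (p : nat -> T -> R).
Context (p0 : forall n a, 0 <= p n a) (p1 : forall n, l1norm (p n) = 1%E).
Implicit Types f g : T -> R.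

Definition wsum n f : R := fine (\esum_(a in [set: T]) (p n a * f a)%:E).

(** [esum] sums nonnegative terms, so averages are treated first on nonnegative bounded functions;
    [umean] and [cmean] extend them to real and complex ones. *)
Definition nnbounded f : Prop := (forall a, 0 <= f a) /\ bounded_rfun f.

Lemma nnboundedD f g : nnbounded f -> nnbounded g -> nnbounded (fun a => f a + g a).
Proof.
move=> [f0 bf] [g0 bg]; split; last exact: bounded_rfunD.
by move=> a; rewrite addr_ge0.
Qed.

Lemma nnboundedZ f (r : R) : 0 <= r -> nnbounded f -> nnbounded (fun a => r * f a).
Proof.
move=> r0 [f0 [M fM]]; split=> [a|]; first by rewrite mulr_ge0.
by exists (`|r| * M) => a; rewrite normrM ler_wpM2l.
Qed.

Lemma nnbounded_le f : nnbounded f -> exists2 M, 0 <= M & forall a, f a <= M.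
Proof.
move=> [f0 [M fM]]; exists `|M| => // a.
by rewrite (le_trans (ler_norm _))// (le_trans (fM a))// ler_norm.
Qed.

Lemma wsum_bound n f M : 0 <= M -> (forall a, f a <= M) ->
  (\esum_(a in [set: T]) (p n a * f a)%:E <= M%:E)%E.
Proof.
move=> M0 fM; rewrite -[leRHS]mule1 -(p1 n) -esumZl//.
by apply: le_esum => a _; rewrite -EFinM lee_fin mulrC (ger0_norm (p0 n a)) ler_wpM2r.
Qed.

Lemma wsumE n f : nnbounded f ->
  (wsum n f)%:E = \esum_(a in [set: T]) (p n a * f a)%:E.
Proof.
move=> bf; have [M M0 fM] := nnbounded_le bf; have [f0 _] := bf.
rewrite fineK// ge0_fin_numE; last first.
  by apply: esum_ge0 => a _; rewrite lee_fin mulr_ge0.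
by apply: le_lt_trans (wsum_bound n M0 fM) _; rewrite ltry.
Qed.

Lemma wsum_ge0 n f : nnbounded f -> 0 <= wsum n f.
Proof.
by move=> bf; apply/fine_ge0/esum_ge0 => a _; rewrite lee_fin mulr_ge0//; have [] := bf.
Qed.

Lemma wsumD n f g : nnbounded f -> nnbounded g ->
  wsum n (fun a => f a + g a) = wsum n f + wsum n g.
Proof.
move=> bf bg; apply: EFin_inj; rewrite EFinD !wsumE//; last exact: nnboundedD.
have [f0 _] := bf; have [g0 _] := bg.
rewrite -esumD; do ?by move=> *; rewrite lee_fin mulr_ge0.
by apply: eq_esum => a _; rewrite mulrDr EFinD.
Qed.

Lemma wsumZ n f (r : R) : 0 <= r -> nnbounded f ->
  wsum n (fun a => r * f a) = r * wsum n f.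
Proof.
move=> r0 bf; apply: EFin_inj; rewrite EFinM !wsumE//; last exact: nnboundedZ.
have [f0 _] := bf; rewrite -esumZl//; last by move=> *; rewrite lee_fin mulr_ge0.
by apply: eq_esum => a _; rewrite mulrCA EFinM.
Qed.

Lemma wsum1 n : wsum n (fun=> 1) = 1.
Proof.
rewrite /wsum -[RHS]/(fine 1%E) -(p1 n); congr fine; apply: eq_esum => a _.
by rewrite mulr1 ger0_norm.
Qed.

(** Averaging [f \o t] against [p n] is averaging [f] against [p n \o s]; the two averages of [f]
    differ by at most a bound of [f] times the l^1 distance of the weights. *)
Lemma wsum_comp (s t : T -> T) f : cancel s t -> cancel t s ->
  (fun n => l1norm (fun a => p n (s a) - p n a)) @ \oo --> 0%E ->
  nnbounded f -> (fun n => wsum n (f \o t) - wsum n f) @ \oo --> 0.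
Proof.
move=> st ts pst bf; have [M M0 fM] := nnbounded_le bf; have [f0 [N fN]] := bf.
have bft : nnbounded (f \o t) by split=> [a|]; [exact: f0|exists N => a; exact: fN].
have ftE n : (wsum n (f \o t))%:E = \esum_(a in [set: T]) (p n (s a) * f a)%:E.
  rewrite wsumE// [LHS](@reindex_esum _ _ _ setT setT s).
    by apply: eq_esum => a _ /=; rewrite st.
  split=> // [a b _ _|a _]; first exact: (can_inj st).
  by exists (t a).
have le (q q' : T -> R) : (forall a, 0 <= q a) -> (forall a, 0 <= q' a) ->
    (\esum_(a in [set: T]) (q a * f a)%:E <=
     \esum_(a in [set: T]) (q' a * f a)%:E + M%:E * l1norm (fun a => q a - q' a)%R)%E.
  move=> q0 q'0; rewrite -esumZl// -esumD; last 2 first.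
  - by move=> a _; rewrite lee_fin mulr_ge0.
  - by move=> a _; rewrite lee_fin mulr_ge0.
  apply: le_esum => a _; rewrite -EFinM -EFinD lee_fin -lerBlDl -mulrBl mulrC.
  apply: le_trans (_ : f a * `|q a - q' a| <= _).
    by rewrite ler_wpM2l// ler_norm.
  by rewrite ler_wpM2r.
pose dlt n := l1norm (fun a => p n (s a) - p n a).
have dlt_sym n : l1norm (fun a => p n a - p n (s a)) = dlt n.
  by apply: eq_esum => a _; rewrite distrC.
have dle n : dlt n \is a fin_num -> `|wsum n (f \o t) - wsum n f| <= M * fine (dlt n).
  move=> dfin; have MdE : (M * fine (dlt n))%:E = (M%:E * dlt n)%E.
    by rewrite EFinM (fineK dfin).
  have h1 : ((wsum n f)%:E <= (wsum n (f \o t))%:E + (M * fine (dlt n))%:E)%E.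
    rewrite MdE (wsumE n bf) (ftE n).
    have := le _ _ (p0 n) (fun a => p0 n (s a)).
    by rewrite [l1norm _](dlt_sym n).
  have h2 : ((wsum n (f \o t))%:E <= (wsum n f)%:E + (M * fine (dlt n))%:E)%E.
    by rewrite MdE (ftE n) (wsumE n bf) le.
  by rewrite ler_distl lerBlDr; apply/andP; split.
apply/norm_cvg0P; have /fine_cvgP[dfin dcvg] := pst.
apply: (@squeeze_cvgr _ _ _ _ (fun=> 0) (fun n => M * fine (dlt n))).
- near=> n; rewrite normr_ge0 dle//; near: n; exact: dfin.
- exact: cvg_cst.
- by rewrite -[X in _ --> X](mulr0 M); apply: cvgM => //; exact: cvg_cst.
Unshelve. all: by end_near.
Qed.

(** The averages stay in a compact interval, so they have a cluster point along [U], and an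
    ultrafilter converges to its cluster points. *)
Lemma ultralimit_mean (U : set_system nat) : UltraFilter U -> \oo `<=` U ->
  forall f, nnbounded f -> cvg (wsum ^~ f @ U).
Proof.
move=> UU ooU f bf; have [M M0 fM] := nnbounded_le bf.
have [|l [_ clus]] := @segment_compact R 0 M (wsum ^~ f @ U) _.
  apply: (@filterE _ U _ (wsum ^~ f @^-1` `[0, M])) => n /=; rewrite in_itv/= wsum_ge0//=.
  by rewrite -lee_fin wsumE// wsum_bound.
apply/cvg_ex; exists l => B lB.
have [//|UB] := in_ultra_setVsetC (wsum ^~ f @^-1` B) UU.
by have [x [/= nBx Bx]] := clus (~` B) B UB lB.
Qed.

Context (U : set_system nat) (UU : UltraFilter U) (ooU : \oo `<=` U).

Definition ulim f : R := lim (wsum ^~ f @ U).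

Lemma ulimP f : nnbounded f -> wsum ^~ f @ U --> ulim f.
Proof. exact: ultralimit_mean. Qed.

Lemma ulimD f g : nnbounded f -> nnbounded g ->
  ulim (fun a => f a + g a) = ulim f + ulim g.
Proof.
move=> bf bg; apply/cvg_lim => //; under eq_fun do rewrite wsumD//.
by apply: cvgD; exact: ulimP.
Qed.

Lemma ulimZ f (r : R) : 0 <= r -> nnbounded f -> ulim (fun a => r * f a) = r * ulim f.
Proof.
move=> r0 bf; apply/cvg_lim => //; under eq_fun do rewrite wsumZ//.
by apply: cvgM; [exact: cvg_cst|exact: ulimP].
Qed.

Lemma ulim1 : ulim (fun=> 1) = 1.
Proof. by apply/cvg_lim => //; under eq_fun do rewrite wsum1; exact: cvg_cst. Qed.

Lemma ulim_ge0 f : nnbounded f -> 0 <= ulim f.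
Proof.
move=> bf; apply: limr_ge; first by apply/cvg_ex; exists (ulim f); exact: ulimP.
by apply: filterE => n; exact: wsum_ge0.
Qed.

Lemma ulim_comp (s t : T -> T) f : cancel s t -> cancel t s ->
  (fun n => l1norm (fun a => p n (s a) - p n a)) @ \oo --> 0%E ->
  nnbounded f -> ulim (f \o t) = ulim f.
Proof.
move=> st ts pst bf; apply/cvg_lim => //.
have := wsum_comp st ts pst bf => /(cvg_trans (cvg_app _ ooU)) h.
rewrite -[X in _ --> X]add0r.
rewrite (_ : wsum ^~ _ = fun n => wsum n (f \o t) - wsum n f + wsum n f); last first.
  by apply/funext => n; rewrite subrK.
by apply: cvgD => //; exact: ulimP.
Qed.

Definition pospart f a := Num.max (f a) 0.

Lemma pospart_bounded f : bounded_rfun f -> nnbounded (pospart f).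
Proof.
move=> [M fM]; split=> [a|]; first by rewrite le_max lexx orbT.
exists M => a; apply: le_trans (fM a); rewrite /pospart.
by case: (lerP (f a) 0); rewrite ?normr0.
Qed.

Lemma pospartB f a : pospart f a - pospart (fun b => - f b) a = f a.
Proof.
rewrite /pospart; case: (lerP (f a) 0); case: (lerP (- f a) 0); lra.
Qed.

Definition umean f : R := ulim (pospart f) - ulim (pospart (fun a => - f a)).

(** Any way of writing a function as a difference of nonnegative bounded ones gives the same value;
    additivity of [umean] follows from this freedom. *)
Lemma umeanB f g : nnbounded f -> nnbounded g ->
  umean (fun a => f a - g a) = ulim f - ulim g.
Proof.
move=> bf bg; have [_ bf'] := bf; have [_ bg'] := bg.
have bfg : bounded_rfun (fun a => f a - g a).
  by apply: bounded_rfunD => //; exact: bounded_rfunN.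
have := ulimD (pospart_bounded bfg) bg.
have := ulimD bf (pospart_bounded (bounded_rfunN bfg)).
rewrite (_ : (fun a => _ + g a) = fun a => f a + pospart (fun b => - (f b - g b)) a).
  by rewrite /umean; lra.
apply/funext => a; have := pospartB (fun a => f a - g a) a; lra.
Qed.

Lemma umeanD f g : bounded_rfun f -> bounded_rfun g ->
  umean (fun a => f a + g a) = umean f + umean g.
Proof.
move=> bf bg; have bf' := pospart_bounded bf; have bg' := pospart_bounded bg.
have bfN := pospart_bounded (bounded_rfunN bf).
have bgN := pospart_bounded (bounded_rfunN bg).
rewrite (_ : (fun a => f a + g a) = fun a => (pospart f a + pospart g a) -
    (pospart (fun b => - f b) a + pospart (fun b => - g b) a)).
  by rewrite umeanB; [|exact: nnboundedD..]; rewrite !ulimD// /umean; lra.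
by apply/funext => a; have := pospartB f a; have := pospartB g a; lra.
Qed.

Lemma umeanN f : umean (fun a => - f a) = - umean f.
Proof.
by rewrite /umean opprB; congr (_ - ulim (pospart _)); apply/funext => a; rewrite opprK.
Qed.

Lemma umeanZ f (r : R) : bounded_rfun f -> umean (fun a => r * f a) = r * umean f.
Proof.
have pos (s : R) g : 0 <= s -> bounded_rfun g -> umean (fun a => s * g a) = s * umean g.
  move=> s0 bg; have bg' := pospart_bounded bg.
  have bgN := pospart_bounded (bounded_rfunN bg).
  rewrite (_ : (fun a => s * g a) = fun a => s * pospart g a - s * pospart (fun b => - g b) a).
    by rewrite umeanB; [|exact: nnboundedZ..]; rewrite !ulimZ// /umean mulrBr.
  by apply/funext => a; rewrite -mulrBr pospartB.
move=> bf; have [r0|/ltW r0] := leP 0 r; first exact: pos.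
rewrite -[RHS]opprK -mulNr -pos ?oppr_ge0// -umeanN.
by congr umean; apply/funext => a; rewrite mulNr opprK.
Qed.

Lemma umean0 : umean (fun=> 0) = 0.
Proof.
have b0 : bounded_rfun (fun _ : T => 0 : R) by exists 0 => a; rewrite normr0.
rewrite -[RHS](mul0r (umean (fun=> 0))) -umeanZ//.
by congr umean; apply/funext => a; rewrite mul0r.
Qed.

Lemma umean_ge0 f : nnbounded f -> umean f = ulim f.
Proof.
move=> bf; have b0 : nnbounded (fun=> 0) by split=> //; exists 0 => a; rewrite normr0.
have := umeanB bf b0; have := @ulimZ (fun=> 0) 0 (lexx _) b0.
under [X in ulim X]eq_fun do rewrite mul0r; rewrite mul0r => ->.
rewrite subr0 => <-; congr umean; apply/funext => a; by rewrite subr0.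
Qed.

Definition cmean (f : T -> R[i]) : R[i] :=
  (umean (fun a => complex.Re (f a)) +i* umean (fun a => complex.Im (f a))).

Lemma bounded_Re (f : T -> R[i]) : bounded_cfun f ->
  bounded_rfun (fun a => complex.Re (f a)) /\ bounded_rfun (fun a => complex.Im (f a)).
Proof.
move=> [M fM]; split; exists M => a; apply: le_trans (fM a); case: (f a) => x y /=;
  by rewrite -sqrtr_sqr ler_sqrt ?lerDl ?lerDr ?addr_ge0 ?sqr_ge0.
Qed.

Lemma cmean_is_mean : is_mean cmean.
Proof.
split.
- move=> [x y] f g /bounded_Re[bRf bIf] /bounded_Re[bRg bIg].
  have bZ (r : R) (h : T -> R) : bounded_rfun h -> bounded_rfun (fun a => r * h a).
    by move=> [M hM]; exists (`|r| * M) => a; rewrite normrM ler_wpM2l.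
  rewrite /cmean.
  rewrite (_ : (fun a => complex.Re _) = fun a => x * complex.Re (f a) +
     ((- y) * complex.Im (f a) + complex.Re (g a))); last first.
    apply/funext => a; case: (f a) (g a) => [u v] [u' v'] /=; ring.
  rewrite (_ : (fun a => complex.Im _) = fun a => x * complex.Im (f a) +
     (y * complex.Re (f a) + complex.Im (g a))); last first.
    apply/funext => a; case: (f a) (g a) => [u v] [u' v'] /=; ring.
  have xR := bZ x _ bRf; have xI := bZ x _ bIf.
  have yR := bZ y _ bRf; have yI := bZ (- y) _ bIf.
  rewrite (umeanD xR (bounded_rfunD yI bRg)) (umeanD yI bRg).
  rewrite (umeanD xI (bounded_rfunD yR bIg)) (umeanD yR bIg) !umeanZ//.
  by apply/eqP; rewrite eq_complex /=; apply/andP; split; apply/eqP; ring.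
- move=> f bf f0; have [bR _] := bounded_Re bf.
  have e a : 0 <= complex.Re (f a) /\ complex.Im (f a) = 0.
    by have := f0 a; rewrite lecE /= => /andP[/eqP]; split.
  have bR0 : nnbounded (fun a => complex.Re (f a)) by split=> // a; have [] := e a.
  rewrite /cmean umean_ge0// (_ : (fun a => complex.Im _) = fun=> 0); last first.
    by apply/funext => a; have [] := e a.
  by rewrite umean0 lecE /= eqxx ulim_ge0.
- rewrite /cmean umean0 umean_ge0 ?ulim1//.
  by split=> //; exists 1 => a; rewrite normr1.
Qed.

End LimitMean.

(** * Reiter sequences on the coset space *)

Section ReiterMean.
Context {R : realType} {G : groupType} (L : set G).

Lemma coset_mulM (g h : G) (c : left_cosets L) :
  coset_mul g (coset_mul h c) = coset_mul (g * h)%g c.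
Proof.
apply/val_inj => /=; apply/seteqP; split=> x /=.
  by move=> [_ [y cy <-] <-]; exists y => //; rewrite mulgA.
by move=> [y cy <-]; exists (h * y)%g; [exists y|rewrite mulgA].
Qed.

Lemma coset_mul1 (c : left_cosets L) : coset_mul 1%g c = c.
Proof.
apply/val_inj => /=; apply/seteqP; split=> x /=.
  by move=> [y cy <-]; rewrite mul1g.
by move=> cx; exists x => //; rewrite mul1g.
Qed.

Lemma coset_mulK (g : G) : cancel (@coset_mul _ L g) (coset_mul g^-1%g).
Proof. by move=> c; rewrite coset_mulM mulVg coset_mul1. Qed.

Lemma coset_mulVK (g : G) : cancel (@coset_mul _ L g^-1%g) (coset_mul g).
Proof. by move=> c; rewrite coset_mulM mulgV coset_mul1. Qed.

(** The ultralimit of averages against [p n], along an ultrafilter finer than [\oo], is a mean;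
    asymptotic invariance of [p n] makes it exactly invariant. *)
Lemma coamenable_of_reiter (p : nat -> left_cosets L -> R) :
  (forall n a, 0 <= p n a) -> (forall n, l1norm (p n) = 1%E) ->
  (forall g, (fun n => l1norm (fun a => p n (coset_mul g a) - p n a)) @ \oo --> 0%E) ->
  coamenable_subgroup R L.
Proof.
move=> p0 p1 pg; have [U [UU ooU]] := @ultraFilterLemma nat \oo _.
exists (cmean p U); split; first exact: cmean_is_mean.
(* Translating the function by [g] amounts to translating the weights by the inverse of [g], hence
   the instance of [pg] taken here. *)
move=> g f /bounded_Re[bR bI]; have := pg g^-1%g => {}pg.
have inv h : bounded_rfun h -> umean p U (h \o coset_mul g) = umean p U h.
  move=> bh; rewrite /umean; congr (_ - _).
    exact: (ulim_comp p0 p1 UU ooU (coset_mulVK g) (coset_mulK g) pg (pospart_bounded bh)).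
  exact: (ulim_comp p0 p1 UU ooU (coset_mulVK g) (coset_mulK g) pg
    (pospart_bounded (bounded_rfunN bh))).
by rewrite /cmean (inv _ bR) (inv _ bI).
Qed.

(** Diagonal choice: the n-th vector comes from [day] for the first n elements of an enumeration of
    the group, with tolerance 2^-n. The geometric rate makes the errors of each fixed [g] summable,
    on which the window argument depends. *)
Lemma reiter_of_coamenable : countable [set: G] -> coamenable_subgroup R L ->
  exists p : nat -> left_cosets L -> R,
  [/\ forall n a, 0 <= p n a, forall n, l1norm (p n) = 1%E &
  forall g, exists n0, forall n, (n0 <= n)%N ->
   (l1norm (fun a => p n (coset_mul g a) - p n a)%R <= (2^-1 ^+ n)%:E)%E].
Proof.
move=> /countable_injP[h /in2TT hinj] [m [mm minv]].
(* A left inverse of the injection [h]; codes that are not attained are sent to the identity. *)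
pose e n : G := xget 1%g [set g | h g = n].
have eh g : e (h g) = g.
  by apply: hinj; apply: (@xgetPex _ 1%g [set g' | h g' = h g]); exists g.
have key n : exists p : left_cosets L -> R, [/\ forall a, 0 <= p a, l1norm p = 1%E &
    forall i : 'I_n, (l1norm (fun a => p (coset_mul (e i) a) - p a)%R <= (2^-1 ^+ n)%:E)%E].
  apply: (day (t := fun i => coset_mul (e i)^-1%g) _ _ mm).
  - by move=> i; exact: coset_mulK.
  - by move=> i; exact: coset_mulVK.
  - by move=> i f; exact: minv.
  - by rewrite exprn_gt0// invr_gt0.
have [p pP] := choice key; exists p; split.
- by move=> n a; have [] := pP n.
- by move=> n; have [] := pP n.
- move=> g; exists (h g).+1 => n hn; have [_ _ /(_ (Ordinal hn))] := pP n.
  by rewrite /= eh.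
Qed.

End ReiterMean.

                                               

(** * Measurability through countable quantifiers and separating families *)

Section CountableQuantifiers.
Context {d} {Z : measurableType d} {I : Type} (cI : countable [set: I]).
Implicit Types (S : set I) (P : I -> set Z).

Lemma measurable_exists S P : (forall i, S i -> measurable (P i)) ->
  measurable [set z | exists2 i, S i & P i z].
Proof.
move=> mP; rewrite (_ : mkset _ = \bigcup_i [set z | S i /\ P i z]).
  apply: countable_bigcupT_measurable => // i.
  have [Si|nSi] := pselect (S i).
    by rewrite (_ : mkset _ = P i); [exact: mP|apply/seteqP; split=> z //= []].
  by rewrite (_ : mkset _ = set0)//; apply/seteqP; split=> z //= [].
by apply/seteqP; split=> [z [i Si Pz]|z [i _ [Si Pz]]]; exists i.
Qed.

Lemma measurable_forall S P : (forall i, S i -> measurable (P i)) ->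
  measurable [set z | forall i, S i -> P i z].
Proof.
move=> mP; rewrite -[X in measurable X]setCK; apply: measurableC.
rewrite (_ : ~` _ = [set z | exists2 i, S i & (~` P i) z]).
  by apply: measurable_exists => i Si; apply: measurableC; exact: mP.
apply/seteqP; split=> z /=; last by move=> [i Si nP] /(_ i Si).
by move=> /existsNP[i /not_implyP[Si nP]]; exists i.
Qed.

End CountableQuantifiers.

                                                                        
                  
(** This is the only trace of standard Borelness used later: it makes coincidence sets of measurable
    maps measurable, and it covers the points moved by a map by countably many sets disjoint from
    their images. *)
Definition point_separating d (X : measurableType d) (B : nat -> set X) : Prop :=
  (forall k, measurable (B k)) /\
  forall x y, x <> y -> exists k, B k x /\ ~ B k y.

Lemma standard_borel_separated (R : realType) d (X : measurableType d) :
  standard_borel R X -> exists B : nat -> set X, point_separating B.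
Proof.
move=> [P [f [hP [b cb [bo bb]] bijf mf]]].
have [h hinj] := countable_injP _ cb.
have mB (U : set P) : b U -> measurable (f @^-1` U).
  by move=> bU; apply/mf; exists U => //; apply: sub_sigma_algebra; exact: bo.
(* The k-th set is the preimage of the basic open set with code [k], and is empty when [k] is not a
   code. *)
exists (fun k => [set x | exists2 U, b U /\ h U = k & U (f x)]); split.
- move=> k; have [[U [bU hU]]|nU] := pselect (exists U, b U /\ h U = k).
    rewrite (_ : mkset _ = f @^-1` U); first exact: mB.
    apply/seteqP; split=> x /=; last by exists U.
    move=> [V [bV hV]]; suff -> : V = U by [].
    by apply: hinj; rewrite ?inE// hV hU.
  rewrite (_ : mkset _ = set0)//; apply/seteqP; split=> x //= [U ? _].
  by apply: nU; exists U.
- move=> x y xy.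
  have fxy : f x != f y by apply/eqP => /(bij_inj bijf).
  have [[U V] [/=]] := (eq_ind _ id hP _ open_hausdorff) _ _ fxy.
  rewrite !inE => Ux Vy [oU oV UV0].
  have [W [[bW Wx] WU]] : exists W, (b W /\ W (f x)) /\ W `<=` U.
    have [W [? ?] ?] := bb (f x) U (open_nbhs_nbhs (conj oU Ux)).
    by exists W.
  exists (h W); split; first by exists W.
  move=> [W' [bW' hW']]; have -> : W' = W by apply: hinj; rewrite ?inE.
  move=> /WU Uy; have : (U `&` V) (f y) by [].
  by rewrite UV0.
Qed.

Lemma measurable_eqset d (X : measurableType d) (B : nat -> set X) d' (Z : measurableType d')
    (f g : Z -> X) : point_separating B ->
  measurable_fun setT f -> measurable_fun setT g -> measurable [set z | f z = g z].
Proof.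
move=> [mB sB] mf mg; rewrite -[X in measurable X]setCK; apply: measurableC.
rewrite (_ : ~` _ = \bigcup_k (f @^-1` B k `&` ~` (g @^-1` B k))).
  apply: bigcupT_measurable => k; apply: measurableI.
    by rewrite -[X in measurable X]setTI; exact: mf.
  by apply: measurableC; rewrite -[X in measurable X]setTI; exact: mg.
apply/seteqP; split=> z /=; first by move=> /sB[k ?]; exists k.
by move=> [k _ /= [Bf Bg] fg]; apply: Bg; rewrite -fg.
Qed.

Lemma measurable_preimage d (X : measurableType d) d' (Z : measurableType d')
  (f : Z -> X) (A : set X) : measurable_fun setT f -> measurable A -> measurable (f @^-1` A).
Proof. by move=> mf mA; rewrite -[X in measurable X]setTI; exact: mf. Qed.

(** * The probability space carried by E *)

Section Restriction.
Context {R : realType} {d} {X : measurableType d} {mu : probability X R}.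
Context {E : set X} (mE : measurable E) (E0 : (0 < mu E)%E).
Local Notation XE := (restr_space mE E0).

Lemma measurable_restr_val : measurable_fun setT (@restr_val _ _ _ _ _ mE E0).
Proof. by move=> _ Y mY; rewrite setTI; exists Y. Qed.

Lemma measurable_into_restr d' (Z : measurableType d') (f : Z -> XE) :
  measurable_fun setT (@restr_val _ _ _ _ _ mE E0 \o f) -> measurable_fun setT f.
Proof. by move=> mf _ _ [B mB <-]; exact: mf. Qed.

(** A retraction of [X] onto [E] with default value [y]; it turns partial translations of [E] into
    total maps. *)
Definition to_restr (y : XE) (x : X) : XE :=
  if pselect (E x) is left Ex then exist (fun x => x \in E) x (mem_set Ex) else y.

Lemma to_restrE y x : E x -> restr_val (to_restr y x) = x.
Proof. by rewrite /to_restr; case: pselect. Qed.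

Lemma to_restrN y x : ~ E x -> to_restr y x = y.
Proof. by rewrite /to_restr; case: pselect. Qed.

Lemma to_restr_val y (z : XE) : to_restr y (restr_val z) = z.
Proof. by apply: restr_val_inj; rewrite to_restrE//; exact: restr_val_in. Qed.

Lemma measurable_to_restr d' (Z : measurableType d') (f : Z -> XE) (g : Z -> X) :
  measurable_fun setT f -> measurable_fun setT g ->
  measurable_fun setT (fun z => to_restr (f z) (g z)).
Proof.
move=> mf mg; apply: measurable_into_restr => _ B mB; rewrite setTI.
rewrite (_ : _ @^-1` _ = (g @^-1` (E `&` B)) `|`
    (~` (g @^-1` E) `&` (f @^-1` (@restr_val _ _ _ _ _ mE E0 @^-1` B)))).
  apply: measurableU; first by apply: measurable_preimage => //; exact: measurableI.
  apply: measurableI; first by apply: measurableC; exact: measurable_preimage.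
  by apply: measurable_preimage => //; exists B.
apply/seteqP; split=> z /=.
  have [Eg|nEg] := pselect (E (g z)); first by rewrite to_restrE//; left.
  by rewrite to_restrN//; right.
by move=> [[Eg Bg]|[nEg Bf]]; [rewrite to_restrE|rewrite to_restrN].
Qed.

Lemma restr_prob_preimage (B : set X) :
  restr_prob mE E0 (@restr_val _ _ _ _ _ mE E0 @^-1` B) = (mu (E `&` B) / mu E)%E.
Proof.
rewrite /restr_prob; congr (mu _ / _)%E; apply/seteqP; split=> [x [y By <-]|x [Ex Bx]].
  by split => //; exact: restr_val_in.
by exists (exist (fun x => x \in E) x (mem_set Ex)).
Qed.

Lemma restr_prob_null (B : set X) : measurable B ->
  mu (E `&` B) = 0%E <-> restr_prob mE E0 (@restr_val _ _ _ _ _ mE E0 @^-1` B) = 0%E.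
Proof.
move=> mB; rewrite restr_prob_preimage; split=> [->|/eqP]; first by rewrite mul0e.
rewrite mule_eq0 => /orP[/eqP//|].
rewrite inve_eq0 => /eqP muE; have := probability_le1 mu mE.
by rewrite muE leye_eq.
Qed.

End Restriction.

                          

(** * Cosets, and the subclasses of an orbit *)

Section Cosets.
Context {G : groupType} {L : set G} (hL : is_subgroup L).

Lemma subgroup1 : L 1%g. Proof. by have [] := hL. Qed.

Lemma subgroupV g : L g -> L g^-1%g.
Proof. by move=> Lg; have [L1 LB] := hL; rewrite -[g^-1%g]mul1g; exact: LB. Qed.

Lemma subgroupM g h : L g -> L h -> L (g * h)%g.
Proof.
by move=> Lg Lh; have [_ LB] := hL; rewrite -[h]invgK; apply: LB => //; exact: subgroupV.
Qed.

Lemma coset_memP (a : left_cosets L) g g' : set_val a g ->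
  set_val a g' <-> L (g^-1 * g')%g.
Proof.
have [h _ aE] := set_valP a; rewrite /set_val/= -aE => -[l Ll <-]; split.
  move=> [l' Ll' <-]; rewrite invgM -mulgA mulKg.
  by apply: subgroupM => //; exact: subgroupV.
move=> Lg'; exists (l * ((h * l)^-1 * g'))%g; first exact: subgroupM.
by rewrite mulgA mulVKg.
Qed.

Lemma coset_eq (a b : left_cosets L) g : set_val a g -> set_val b g -> a = b.
Proof.
move=> ag bg; apply/val_inj/seteqP; split=> g' /=.
  by move=> /(coset_memP g' ag) h; apply/(coset_memP g' bg).
by move=> /(coset_memP g' bg) h; apply/(coset_memP g' ag).
Qed.

Lemma coset_ex g : exists a : left_cosets L, set_val a g.
Proof.
have ac : [set (g * l)%g | l in L] \in left_cosets L by apply/mem_set; exists g.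
exists (exist (fun c => c \in left_cosets L) _ ac); exists 1%g; first exact: subgroup1.
by rewrite mulg1.
Qed.

Lemma coset_nonempty (a : left_cosets L) : exists g, set_val a g.
Proof.
have [h _ aE] := set_valP a; exists h; rewrite /set_val/= -aE; exists 1%g.
  exact: subgroup1.
by rewrite mulg1.
Qed.

Lemma countable_cosets : countable [set: G] -> countable [set: left_cosets L].
Proof.
move=> /countable_injP[h /in2TT hinj].
apply/countable_injP; exists (fun a => h (sval (cid (coset_nonempty a)))).
move=> a b _ _ /hinj e; apply: (coset_eq (svalP (cid (coset_nonempty a)))).
by rewrite e; exact: (svalP (cid (coset_nonempty b))).
Qed.

End Cosets.

Section Orbits.
Context {R : realType} {d} {X : measurableType d} {mu : probability X R}.
Context {G : groupType} {L : set G} (hL : is_subgroup L).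
Context {act : G -> X -> X} (hact : pmp_action mu act).
Context {E : set X} {mE : measurable E} {E0 : (0 < mu E)%E}.
Local Notation XE := (restr_space mE E0).
Local Notation val := (@restr_val _ _ _ _ _ mE E0).
Local Notation Q := (restr_rel mE E0 (orbit_rel act setT)).
Local Notation S := (restr_rel mE E0 (orbit_rel act L)).

Lemma act_one x : act 1%g x = x. Proof. by have [->] := hact. Qed.

Lemma act_mul g h x : act (g * h)%g x = act g (act h x).
Proof. by have [_ ->] := hact. Qed.

Lemma actK g : cancel (act g) (act g^-1%g).
Proof. by move=> x; rewrite -act_mul mulVg act_one. Qed.

Lemma actVK g : cancel (act g^-1%g) (act g).
Proof. by move=> x; rewrite -act_mul mulgV act_one. Qed.

Lemma measurable_act g : measurable_fun setT (act g).
Proof. by have [_ _ +] := hact. Qed.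

Lemma act_preserves g A : measurable A -> mu (act g @^-1` A) = mu A.
Proof. by move=> mA; have [_ _ _ ->] := hact. Qed.

Lemma orbitP (y z : XE) : Q (y, z) <-> exists g, val z = act g (val y).
Proof. by split=> [[g _ /= ->]|[g zE]]; exists g. Qed.

Lemma classP (y z : XE) : xsection S y z <-> exists2 l, L l & val z = act l (val y).
Proof. by rewrite /xsection /= inE. Qed.

Lemma xsection_orbitP (y z : XE) : xsection Q y z <-> exists g, val z = act g (val y).
Proof. by rewrite -orbitP /xsection /= inE. Qed.

                                                                             
                                                                
(** The inverse makes this well defined on left cosets: [(g * l)^-1] moves [x] within the L-orbit of
    [g^-1 x]. The point [x] may lie outside [E], and the class is empty when that orbit misses
    [E]. *)
Definition coset_class (x : X) (a : left_cosets L) : set XE :=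
  [set y | exists2 g, set_val a g & val y = act g^-1%g x].

Lemma coset_class_act h x a :
  coset_class (act h x) a = coset_class x (coset_mul h^-1%g a).
Proof.
apply/seteqP; split=> y /=.
  move=> [g ag yE]; exists (h^-1 * g)%g; first by exists g.
  by rewrite yE invgM invgK act_mul.
move=> [_ [g ag <-] yE]; exists g => //.
by rewrite yE invgM invgK act_mul.
Qed.

Lemma coset_class_xsection x a y : coset_class x a y -> coset_class x a = xsection S y.
Proof.
move=> [g ag yE]; apply/seteqP; split=> z; rewrite classP.
  move=> [g' ag' zE]; exists (g'^-1 * g)%g; last by rewrite zE yE act_mul actVK.
  by apply/(coset_memP hL g ag').
move=> [l Ll zE]; exists (g * l^-1)%g; last by rewrite zE yE invgM invgK act_mul.
by apply/(coset_memP hL _ ag); rewrite mulgA mulVg mul1g; exact: subgroupV.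
Qed.

Lemma xsection_self y : xsection S y y.
Proof. by apply/classP; exists 1%g; [exact: subgroup1|rewrite act_one]. Qed.

Lemma coset_class_eq x a y : coset_class x a = xsection S y <-> coset_class x a y.
Proof. by split=> [->|]; [exact: xsection_self|exact: coset_class_xsection]. Qed.

(** The subclasses seen from [y] can be listed by cosets from any base point [x] of its orbit, so
    that vectors at different points of one orbit are compared over one index set. *)
Lemma subclasses_coset_class (x : X) (y : XE) h : val y = act h x ->
  subclasses Q S y = coset_class x @` [set a | coset_class x a !=set0].
Proof.
move=> yE; apply/seteqP; split=> c /=.
  move=> [z /xsection_orbitP[g zE] <-].
  have [a ag] := coset_ex hL (g * h)^-1%g.
  have za : coset_class x a z by exists (g * h)^-1%g => //; rewrite invgK zE yE act_mul.
  by exists a; [exists z|exact: coset_class_xsection].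
move=> [a [z za] <-]; exists z; last by rewrite (coset_class_xsection za).
apply/xsection_orbitP; have [g ag zE] := za.
by exists (g^-1 * h^-1)%g; rewrite act_mul zE yE actK.
Qed.

(** A point of a common class is [g^-1 x] and [g'^-1 x] with representatives of the two cosets, and
    trivial stabiliser gives [g = g']. Without freeness several cosets may share a class, hence the
    fibre sums in the proof of (i). *)
Lemma coset_class_inj x : (forall g, act g x = x -> g = 1%g) ->
  {in [set a | coset_class x a !=set0] &, injective (coset_class x)}.
Proof.
move=> fx a b; rewrite !inE => -[y ya] [z zb] e.
have := ya; rewrite e => -[g bg yE]; have [g' ag' yE'] := ya.
suff gg' : g = g' by apply: (coset_eq hL ag'); rewrite -gg'.
have : (g' * g^-1)%g = 1%g by apply: fx; rewrite act_mul -yE yE' actVK.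
by move/eqP; rewrite mulg_eq1 invgK => /eqP.
Qed.

Lemma quot_rel_orbit (y z : XE) : Q (y, z) <-> quot_rel Q S (y, xsection S z).
Proof.
split=> [/orbitP Qyz|[z' /= /xsection_orbitP[g z'E] e]].
  by exists z => //=; exact/xsection_orbitP.
apply/orbitP; have : xsection S z' z by rewrite e; exact: xsection_self.
by move=> /classP[l _ ->]; exists (l * g)%g; rewrite z'E act_mul.
Qed.

Definition translate (u : G) (y : XE) : XE := to_restr y (act u (val y)).

Lemma translateE u y : E (act u (val y)) -> val (translate u y) = act u (val y).
Proof. exact: to_restrE. Qed.

Lemma translate_orbit u y : Q (y, translate u y).
Proof.
apply/orbitP; have [Eu|nEu] := pselect (E (act u (val y))).
  by exists u; rewrite translateE.
by exists 1%g; rewrite /translate to_restrN// act_one.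
Qed.

Lemma translateVK u y : E (act u (val y)) -> translate u^-1%g (translate u y) = y.
Proof.
move=> Eu; apply: restr_val_inj.
by rewrite translateE translateE// actK//; exact: restr_val_in.
Qed.

Lemma measurable_act_val u : measurable_fun setT (act u \o val).
Proof. by apply: measurableT_comp; [exact: measurable_act|exact: measurable_restr_val]. Qed.

Lemma measurable_translate u : measurable_fun setT (translate u).
Proof. by apply: measurable_to_restr; [exact: measurable_id|exact: measurable_act_val]. Qed.

Lemma measurable_translate_dom u : measurable [set y : XE | E (act u (val y))].
Proof. exact: (measurable_preimage (measurable_act_val u) mE). Qed.

Context {B : nat -> set X} (sB : point_separating B) (cG : countable [set: G]).

Lemma measurable_coset_class_nonempty a :
  measurable [set x : X | coset_class x a !=set0].
Proof.
rewrite (_ : mkset _ = [set x | exists2 g, set_val a g & E (act g^-1%g x)]).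
  apply: (measurable_exists cG) => g _.
  exact: (measurable_preimage (measurable_act g^-1%g) mE).
apply/seteqP; split=> x /=.
  by move=> [y [g ag yE]]; exists g => //; rewrite -yE; exact: restr_val_in.
move=> [g ag Eg]; exists (to_restr point (act g^-1%g x)), g => //.
exact: to_restrE.
Qed.

Lemma measurable_class_eq a (gam : XE -> XE) : measurable_fun setT gam ->
  measurable [set y : XE | coset_class (val y) a = xsection S (gam y)].
Proof.
move=> mgam.
rewrite (_ : mkset _ = [set y | exists2 g, set_val a g &
    (val \o gam) y = (act g^-1%g \o val) y]).
  apply: (measurable_exists cG) => g _; apply: (measurable_eqset sB).
    exact: measurableT_comp (@measurable_restr_val _ _ _ _ _ mE E0) mgam.
  exact: measurable_act_val.
by apply/seteqP; split=> y /= /coset_class_eq.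
Qed.

Lemma measurable_orbit (gam : XE -> XE) : measurable_fun setT gam ->
  measurable [set y : XE | Q (y, gam y)].
Proof.
move=> mgam.
rewrite (_ : mkset _ = [set y | exists2 g, setT g &
    (val \o gam) y = (act g \o val) y]).
  apply: (measurable_exists cG) => g _; apply: (measurable_eqset sB).
    exact: measurableT_comp (@measurable_restr_val _ _ _ _ _ mE E0) mgam.
  exact: measurable_act_val.
by apply/seteqP; split=> y /= [g _ gE]; exists g.
Qed.

Lemma full_group_involution (sig : XE -> XE) : involutive sig ->
  measurable_fun setT sig -> (forall y, Q (y, sig y)) ->
  full_group (restr_prob mE E0) Q sig.
Proof.
move=> sigK msig Qsig; split=> //; first by exists sig.
- move=> A mA; rewrite (_ : _ @` A = sig @^-1` A); first exact: measurable_preimage.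
  apply/seteqP; split=> [_ [y Ay <-]|y Ay] /=; first by rewrite sigK.
  by exists (sig y) => //; rewrite sigK.
- exact: aeW.
Qed.

(** * Measurability of quotient functions along partial translations *)

Section ClassFunctions.
Context (f : XE * set XE -> R).
Context (mf : forall Y : set R, measurable Y ->
  quot_borel (restr_prob mE E0) Q S (quot_rel Q S `&` [set p | Y (f p)])).

Lemma measurable_class_involution (sig : XE -> XE) (Y : set R) : involutive sig ->
  measurable_fun setT sig -> (forall y, Q (y, sig y)) -> measurable Y ->
  measurable [set y | Y (f (y, xsection S (sig y)))].
Proof.
move=> sigK msig Qsig mY.
have [_ /(_ sig (full_group_involution sigK msig Qsig))] := mf mY.
congr measurable; apply/seteqP; split=> y /=; first by case.
by move=> Yf; split=> //; apply/quot_rel_orbit.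
Qed.

                                                                              
                                                    
(** The quotient Borel structure tests only against bijections in the full group, and [translate u]
    need not be one. On a set [A] disjoint from its translate it agrees with the involution that
    swaps the two sets and fixes all other points. *)
Lemma measurable_class_disjoint u (A : set XE) (Y : set R) : measurable A ->
  (forall y, A y -> E (act u (val y))) -> (forall y, A y -> ~ A (translate u y)) ->
  measurable Y ->
  measurable (A `&` [set y | Y (f (y, xsection S (translate u y)))]).
Proof.
move=> mA AE AA mY.
pose A' := [set y | E (act u^-1%g (val y))] `&` (translate u^-1%g @^-1` A).
have mA' : measurable A'.
  apply: measurableI; first exact: measurable_translate_dom.
  exact: (measurable_preimage (measurable_translate _) mA).
have trA y : A y -> A' (translate u y).
  move=> Ay; split; last by rewrite /= translateVK//; exact: AE.
  by rewrite /= translateE ?actK; [exact: restr_val_in|exact: AE].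
have trA' y : A' y -> translate u (translate u^-1%g y) = y.
  by move=> [Eu _]; rewrite -{1}[u]invgK translateVK.
have AA' y : A' y -> ~ A y.
  by move=> A'y Ay; have [_ /= A''] := A'y; apply: (AA _ A''); rewrite trA'.
pose sig y := if pselect (A y) is left _ then translate u y else
  if pselect (A' y) is left _ then translate u^-1%g y else y.
have sigA y : A y -> sig y = translate u y by rewrite /sig; case: pselect.
have sigA' y : A' y -> sig y = translate u^-1%g y.
  by move=> A'y; rewrite /sig; case: pselect => [/(AA' _ A'y)//|_]; case: pselect.
have sigN y : ~ A y -> ~ A' y -> sig y = y.
  by move=> nA nA'; rewrite /sig; case: pselect => // _; case: pselect.
have sigK : involutive sig.
  move=> y; have [Ay|nAy] := pselect (A y).
    by rewrite [sig y]sigA// sigA' ?translateVK//; [exact: AE|exact: trA].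
  have [A'y|nA'y] := pselect (A' y); last by rewrite !sigN// sigN.
  by have [_ A''] := A'y; rewrite [sig y]sigA'// sigA// trA'.
have msig : measurable_fun setT sig.
  move=> _ C mC; rewrite setTI (_ : sig @^-1` C = (A `&` translate u @^-1` C) `|`
      (A' `&` translate u^-1%g @^-1` C) `|` (~` A `&` ~` A' `&` C)).
    apply: measurableU; last by do !apply: measurableI => //; exact: measurableC.
    by apply: measurableU; apply: measurableI => //;
      apply: measurable_preimage => //; exact: measurable_translate.
  apply/seteqP; split=> y /=.
    have [Ay|nAy] := pselect (A y); first by rewrite sigA//; left; left.
    have [A'y|nA'y] := pselect (A' y); first by rewrite sigA'//; left; right.
    by rewrite sigN//; right.
  by move=> [[[Ay]|[A'y]]|[[nAy nA'y]]]; [rewrite sigA|rewrite sigA'|rewrite sigN].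
have Qsig y : Q (y, sig y).
  rewrite /sig; case: pselect => _; first exact: translate_orbit.
  case: pselect => _; first exact: translate_orbit.
  by apply/orbitP; exists 1%g; rewrite act_one.
rewrite (_ : _ `&` _ = A `&` [set y | Y (f (y, xsection S (sig y)))]).
  by apply: measurableI => //; exact: measurable_class_involution.
by apply/seteqP; split=> y /= [Ay]; rewrite sigA.
Qed.

(** The domain splits into points fixed by [u], handled by the identity, and moved points, covered
    by the countably many sets [A k]. *)
Lemma measurable_class_fun u :
  measurable_fun [set y : XE | E (act u (val y))] (fun y => f (y, xsection S (translate u y))).
Proof.
move=> mD Y mY; have [mB sepB] := sB.
(* Points of [B k] whose translate leaves [B k]: such a set is disjoint from its translate, and
   separation makes these sets cover all moved points. *)
pose A k := [set y : XE | E (act u (val y))] `&` (val @^-1` B k) `&`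
  ~` ((val \o translate u) @^-1` B k).
have mA k : measurable (A k).
  apply: measurableI; first apply: measurableI => //.
    by apply: measurable_preimage => //; exact: measurable_restr_val.
  apply: measurableC; apply: measurable_preimage => //.
  apply: measurableT_comp; first exact: measurable_restr_val.
  exact: measurable_translate.
rewrite (_ : _ `&` _ = (\bigcup_k (A k `&` [set y | Y (f (y, xsection S (translate u y)))]))
   `|` ([set y | val (translate u y) = val y] `&` [set y | E (act u (val y))] `&`
        [set y | Y (f (y, xsection S y))])).
  apply: measurableU.
    apply: bigcupT_measurable => k; apply: measurable_class_disjoint => //.
      by move=> y [[]].
    by move=> y [_ nB] [[_ /= /nB]].
  apply: measurableI; first apply: measurableI => //.
    apply: (measurable_eqset sB); last exact: measurable_restr_val.
    apply: measurableT_comp; first exact: measurable_restr_val.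
    exact: measurable_translate.
  apply: (@measurable_class_involution id) => // y.
  by apply/orbitP; exists 1%g; rewrite act_one.
apply/seteqP; split=> y /=.
  move=> [Eu Yf]; have [e|/sepB[k [Bk nBk]]] := pselect (val y = val (translate u y)).
    right; split; first by split; rewrite -?e.
    by rewrite [X in xsection _ X](restr_val_inj e).
  by left; exists k.
move=> [[k _ [[[Eu _] _] Yf]]|[[e Eu] Yf]]; split=> //.
by rewrite (restr_val_inj e).
Qed.

End ClassFunctions.

End Orbits.

                                

(** * Integrals, null sets and invariance of the measure *)

Section NonMeasurableIntegrals.
Context {R : realType} {d} {X : measurableType d} (mu : {measure set X -> \bar R}).
Local Open Scope ereal_scope.

                                                                          
                                                              
(** The integral of a nonnegative function is a supremum over simple functions below it, so it is
    monotone on arbitrary functions. It is applied to the section counts in [rel_measure], whose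
    measurability is not established here. *)
Lemma le_nnintegral (f g : X -> \bar R) : (forall x, 0 <= f x) -> (forall x, f x <= g x) ->
  \int[mu]_x f x <= \int[mu]_x g x.
Proof.
move=> f0 fg; rewrite !ge0_integralTE//; last by move=> x; exact: le_trans (fg x).
by apply: le_ereal_sup => _ [h hf <-]; exists h => // x; exact: le_trans (hf x) (fg x).
Qed.

Lemma nnintegral_support_null (f : X -> \bar R) (N : set X) : measurable N -> mu N = 0 ->
  (forall x, 0 <= f x) -> (forall x, ~ N x -> f x = 0) -> \int[mu]_x f x = 0.
Proof.
move=> mN N0 f0 fN; apply/eqP; rewrite eq_le integral_ge0// andbT.
apply: (@le_trans _ _ (\int[mu]_x ((cst +oo) \_ N) x)).
  apply: le_nnintegral => // x; rewrite patchE; case: ifPn => [_|/negP xN]; first exact: leey.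
  by rewrite fN// => Nx; apply: xN; rewrite inE.
rewrite -integral_mkcond integral_cst//=.
by rewrite N0 mule0.
Qed.

End NonMeasurableIntegrals.

Section AlmostEverywhere.
Context {R : realType} {d} {X : measurableType d} (mu : {measure set X -> \bar R}).

Lemma ae_countable (I : Type) (P : I -> X -> Prop) : countable [set: I] ->
  (forall i, {ae mu, forall x, P i x}) -> {ae mu, forall x, forall i, P i x}.
Proof.
move=> /countable_injP[h /in2TT hinj] aeP.
have : {ae mu, forall x, forall n : nat, forall i, h i = n -> P i x}.
  apply: ae_foralln => n; have [[i hi]|nh] := pselect (exists i, h i = n).
    by apply: filterS (aeP i) => x Px j hj; rewrite (hinj j i)// hj hi.
  by apply: aeW => x i hi; case: nh; exists i.
by apply: filterS => x Px i; exact: (Px (h i)).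
Qed.

Lemma ae_preimage (t : X -> X) (P : X -> Prop) : measurable_fun setT t ->
  (forall A, measurable A -> mu (t @^-1` A) = mu A) ->
  {ae mu, forall x, P x} -> {ae mu, forall x, P (t x)}.
Proof.
move=> mt tmu [N [mN N0 PN]]; exists (t @^-1` N); split.
- exact: measurable_preimage.
- by rewrite tmu.
- by move=> x /= nP; exact: PN.
Qed.

Lemma ge0_integral_preserving (t : X -> X) (f : X -> \bar R) : measurable_fun setT t ->
  (forall A, measurable A -> mu (t @^-1` A) = mu A) ->
  measurable_fun setT f -> (forall x, (0 <= f x)%E) ->
  (\int[mu]_x f (t x) = \int[mu]_x f x)%E.
Proof.
move=> mt tmu mf f0.
have := @ge0_integral_pushforward _ _ _ _ R t mt mu setT f measurableT mf (fun x _ => f0 x).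
rewrite preimage_setT /= => <-.
by apply: eq_measure_integral => A mA _; exact: tmu.
Qed.

End AlmostEverywhere.

Section AlmostEverywhereRestr.
Context {R : realType} {d} {X : measurableType d} {mu : probability X R}.
Context {E : set X} {mE : measurable E} {E0 : (0 < mu E)%E}.
Local Notation XE := (restr_space mE E0).
Local Notation val := (@restr_val _ _ _ _ _ mE E0).

Lemma ae_restr (P : XE -> Prop) : {ae restr_prob mE E0, forall y, P y} ->
  {ae mu, forall x, forall y, val y = x -> P y}.
Proof.
move=> [_ [[B mB <-] B0 PB]]; exists (E `&` B); split.
- exact: measurableI.
- by move/(restr_prob_null mE E0 mB) : B0.
- move=> x /= /existsNP[y /not_implyP[<- nP]]; split; first exact: restr_val_in.
  exact: PB.
Qed.

End AlmostEverywhereRestr.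

(** * From l2 closeness to l1 closeness of squares *)

Section SquareDifference.
Context {R : realType} {T : choiceType}.
Implicit Types f g : T -> R[i].
Local Notation normc := Normc.normc.

(** Factor the difference of squares, bound [|z| - |w|] by [|z - w|], and apply Young's inequality
    with parameter [e]. Summed termwise, this plays the role of Cauchy-Schwarz. *)
Lemma normc_sqrB (z w : R[i]) (e : R) : 0 < e ->
  `|normc z ^+ 2 - normc w ^+ 2| <=
  (2 * e)^-1 * normc (z - w) ^+ 2 + e * (normc z ^+ 2 + normc w ^+ 2).
Proof.
move=> e0.
have n0 (x : R[i]) : 0 <= normc x by case: x => u v /=; exact: sqrtr_ge0.
have tri : `|normc z - normc w| <= normc (z - w).
  have D (x y : R[i]) : normc (x + y) <= normc x + normc y := le_normcD x y.
  rewrite ler_norml; have := D (z - w) w; have := D (w - z) z; rewrite !subrK.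
  have -> : normc (w - z) = normc (z - w).
    by rewrite -(opprB z w); exact: (normcN (z - w)).
  by move=> h1 h2; apply/andP; split; lra.
set a := normc z in tri *; set b := normc w in tri *; set c := normc (z - w) in tri *.
have a0 : 0 <= a by exact: n0.
have b0 : 0 <= b by exact: n0.
have c0 : 0 <= c by exact: n0.
rewrite subr_sqr normrM (ger0_norm (addr_ge0 a0 b0)).
apply: (@le_trans _ _ (c * (a + b))); first by rewrite ler_wpM2r// addr_ge0.
(* With [c = q * e] the inequality becomes polynomial, and follows from the two squares below. *)
pose q := c / e; have -> : c = q * e by rewrite /q divfK// gt_eqF.
have -> : (2 * e)^-1 * (q * e) ^+ 2 = 2^-1 * q ^+ 2 * e by field; rewrite gt_eqF.
have h1 : 0 <= e * (q - (a + b)) ^+ 2 by rewrite mulr_ge0 ?sqr_ge0 ?ltW.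
have h2 : 0 <= e * (a - b) ^+ 2 by rewrite mulr_ge0 ?sqr_ge0 ?ltW.
by nra.
Qed.

Lemma esum_sqrB (D : set T) f g (e : R) : 0 < e ->
  (\esum_(c in D) (normc (f c) ^+ 2)%:E = 1)%E ->
  (\esum_(c in D) (normc (g c) ^+ 2)%:E = 1)%E ->
  (\esum_(c in D) `|normc (f c) ^+ 2 - normc (g c) ^+ 2|%:E <=
   (2 * e)^-1%:E * (\esum_(c in D) (normc (f c - g c) ^+ 2)%:E) + (2 * e)%:E)%E.
Proof.
move=> e0 f1 g1.
have e2 : 0 <= (2 * e)^-1 by rewrite invr_ge0 mulr_ge0// ltW.
have q0 (x : R) : (0 <= (x ^+ 2)%:E)%E by rewrite lee_fin sqr_ge0.
have -> : (2 * e)%:E = (e%:E * \esum_(c in D) (normc (f c) ^+ 2 + normc (g c) ^+ 2)%:E)%E.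
  under eq_esum do rewrite EFinD.
  by rewrite esumD// f1 g1 [X in (e%:E * X)%E](_ : _ = 2%:E)// -EFinM mulrC.
rewrite -!esumZl//; last 2 first.
- exact: ltW.
- by move=> c; rewrite lee_fin addr_ge0 ?sqr_ge0.
rewrite -esumD; last 2 first.
- by move=> c _; rewrite -EFinM lee_fin mulr_ge0 ?sqr_ge0.
- by move=> c _; rewrite -EFinM lee_fin mulr_ge0 ?(ltW e0)// addr_ge0 ?sqr_ge0.
apply: le_esum => c _; rewrite -!EFinM -EFinD lee_fin; exact: normc_sqrB.
Qed.

End SquareDifference.

                                                                                        

(** * Points whose whole orbit behaves well *)

Section GoodPoints.
Context {R : realType} {d} {X : measurableType d} {mu : probability X R}.
Context {G : groupType} (cG : countable [set: G]) {L : set G} (hL : is_subgroup L).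
Context {act : G -> X -> X} (hact : pmp_action mu act).
Context {B : nat -> set X} (sB : point_separating B).
Context {E : set X} {mE : measurable E} {E0 : (0 < mu E)%E}.
Local Notation XE := (restr_space mE E0).
Local Notation val := (@restr_val _ _ _ _ _ mE E0).
Local Notation Q := (restr_rel mE E0 (orbit_rel act setT)).
Local Notation S := (restr_rel mE E0 (orbit_rel act L)).
Local Notation translate := (@translate _ _ _ _ _ act _ mE E0).

Lemma counting_ge1 (T : choiceType) (A : set T) (t : T) : A t -> (1 <= counting A :> \bar R)%E.
Proof.
move=> At; rewrite /counting; case: ifPn => [/asboolP fA|_]; last exact: leey.
rewrite lee_fin ler1n cardfs_gt0; apply/fset0Pn; exists t.
by rewrite in_fset_set// inE.
Qed.

(** For fixed [w], the indicator of the points [y] with [(y, w y)] in [A] is at most the section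
    count of [A], so these points form a null set; there are countably many [w]. *)
Lemma rel_measure_null_translate (A : set (XE * XE)) : measurable A ->
  rel_measure (restr_prob mE E0) Q A = 0%E ->
  {ae restr_prob mE E0, forall y, forall w, ~ (E (act w (val y)) /\ A (y, translate w y))}.
Proof.
move=> mA A0; apply: (ae_countable (mu := restr_prob mE E0)) => // w.
pose Aw : set XE := [set y | E (act w (val y)) /\ A (y, translate w y)].
have mAw : measurable Aw.
  apply: measurableI; first exact: measurable_translate_dom.
  apply: (measurable_preimage _ mA).
  by apply: measurable_fun_pair => //; exact: measurable_translate.
exists Aw; split=> //; last by move=> y /= /contrapT.
apply/eqP; rewrite eq_le measure_ge0 andbT -A0 /rel_measure.
rewrite -[leLHS](_ : \int[restr_prob mE E0]_y (\1_Aw y)%:E = _)%E; last first.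
  by rewrite integral_indic// setIT.
apply: le_nnintegral => y; first by rewrite lee_fin.
rewrite indicE; have [|_] := boolP (y \in Aw); last first.
  by rewrite /counting; case: ifPn; rewrite ?leey// => _; rewrite lee_fin.
rewrite inE => -[Ew Ay]; apply: (@counting_ge1 _ _ (translate w y)).
by rewrite /xsection /= inE; split=> //; exact: translate_orbit.
Qed.

Context (xi : nat -> XE * set XE -> R[i]).

(** The conditions range over all points of the orbit of [x] lying in [E], so they can be used after
    any change of base point. *)
Definition good (x : X) : Prop :=
  [/\ forall g, act g x = x -> g = 1%g,
      forall n g (y : XE), val y = act g x ->
        l2norm (subclasses Q S y) (fun c => xi n (y, c)) = 1%E &
      forall g h (y z : XE), val y = act g x -> val z = act h x ->
        (fun n => l2norm (subclasses Q S y) (fun c => xi n (y, c) - xi n (z, c)))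
          @ \oo --> 0%E].

Lemma ae_good : essentially_free mu act ->
  (forall n, {ae restr_prob mE E0, forall y,
     l2norm (subclasses Q S y) (fun c => xi n (y, c)) = 1%E}) ->
  {ae rel_measure (restr_prob mE E0) Q, forall p : XE * XE, Q p ->
     (fun n => l2norm (subclasses Q S p.1) (fun c => xi n (p.1, c) - xi n (p.2, c)))
        @ \oo --> 0%E} ->
  {ae mu, forall x, good x}.
Proof.
move=> free xi1 [N [mN N0 xiN]].
(* A property holding a.e. on [E] holds, for a.e. [x] in [X], at all points of its orbit in [E]:
   pull the null set back by each group element. *)
have pull (P : XE -> Prop) : {ae restr_prob mE E0, forall y, P y} ->
    {ae mu, forall x, forall g y, val y = act g x -> P y}.
  move=> aeP; apply: (ae_countable (mu := mu)) => // g.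
  apply: (ae_preimage (P := fun x => forall y, val y = x -> P y)).
  - exact: (measurable_act hact g).
  - by move=> A mA; exact: (act_preserves hact g mA).
  - exact: ae_restr.
have h1 := pull _ (ae_foralln xi1).
have h2 := pull _ (rel_measure_null_translate mN N0).
apply: filterS3 free h1 h2 => x fx h1x h2x; split=> //.
- by move=> n g y yE; exact: (h1x g y yE n).
- move=> g h y z yE zE; have Qyz : Q (y, z).
    by apply/orbitP; exists (h * g^-1)%g; rewrite (act_mul hact) yE (actK hact).
  apply: contrapT => ncvg; apply: (h2x g y yE (h * g^-1)%g).
  have zEy : act (h * g^-1)%g (val y) = val z by rewrite (act_mul hact) yE (actK hact).
  rewrite /translate zEy to_restr_val; split; first exact: restr_val_in.
  by apply: xiN => /= k; apply: ncvg; exact: (k Qyz).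
Qed.

End GoodPoints.

(** * Convergence to zero in the extended reals *)

Section NonnegConvergence.
Context {R : realType}.
Local Open Scope ereal_scope.

Lemma nonneg_cvg0P (u : nat -> \bar R) : (forall n, 0 <= u n) ->
  u @ \oo --> 0 <-> (forall e : R, (0 < e)%R -> \forall n \near \oo, u n <= e%:E).
Proof.
move=> u0; split=> [/fine_cvgP[ufin /cvgr0Pnorm_le uc] e e0|uc].
  have {}uc := uc e e0; near=> n.
  have un : u n \is a fin_num by near: n.
  rewrite -(fineK un) lee_fin; apply: le_trans (ler_norm _) _.
  by near: n.
apply/fine_cvgP; split.
  have := uc 1%R ltr01; apply: filterS => n un.
  by rewrite ge0_fin_numE//; apply: le_lt_trans un _; rewrite ltry.
apply/cvgr0Pnorm_le => e e0; have := uc e e0; apply: filterS => n un /=.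
have ufin : u n \is a fin_num.
  by rewrite ge0_fin_numE//; apply: le_lt_trans un _; rewrite ltry.
by rewrite ger0_norm ?fine_ge0// -lee_fin fineK.
Unshelve. all: by end_near.
Qed.

Lemma l2norm_le (T : choiceType) (C : set T) (f : T -> R[i]) (t : R) : (0 <= t)%R ->
  (l2norm C f <= t%:E) = (\esum_(c in C) (Normc.normc (f c) ^+ 2)%:E <= (t ^+ 2)%:E).
Proof.
move=> t0; rewrite EFin_expe -[in RHS](@sqr_sqrte _ (esum _ _)); last first.
  by apply: esum_ge0 => c _; rewrite lee_fin sqr_ge0.
by rewrite lee_sqr// sqrte_ge0.
Qed.

Lemma l2norm1 (T : choiceType) (C : set T) (f : T -> R[i]) :
  (l2norm C f = 1) <-> (\esum_(c in C) (Normc.normc (f c) ^+ 2)%:E = 1).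
Proof.
have e0 : 0 <= \esum_(c in C) (Normc.normc (f c) ^+ 2)%:E.
  by apply: esum_ge0 => c _; rewrite lee_fin sqr_ge0.
rewrite /l2norm; split=> [h|->]; first by rewrite -[LHS]sqr_sqrte// h expe2 mule1.
by rewrite /= sqrtr1.
Qed.

End NonnegConvergence.

(** * Measurable choice of a point of E on each orbit meeting E *)

Section FirstReturn.
Context {R : realType} {d} {X : measurableType d} {mu : probability X R}.
Context {G : groupType} (cG : countable [set: G]).
Context {act : G -> X -> X} (hact : pmp_action mu act).
Context {E : set X} (mE : measurable E).
Context {h : G -> nat} (hinj : injective h).

                                                                               
                              
(** Ordering the group by the injection [h] makes the element that brings [x] into [E] unique and
    its level sets measurable. *)
Definition first_entry (g : G) : set X :=
  [set x | E (act g x) /\ forall g', (h g' < h g)%N -> ~ E (act g' x)].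

Lemma measurable_first_entry g : measurable (first_entry g).
Proof.
apply: measurableI; first exact: (measurable_preimage (measurable_act hact g) mE).
apply: (measurable_forall (S := [set g' | (h g' < h g)%N]) cG) => g' _.
by apply: measurableC; exact: (measurable_preimage (measurable_act hact g') mE).
Qed.

Lemma first_entry_uniq x g g' : first_entry g x -> first_entry g' x -> g = g'.
Proof.
move=> [Eg ming] [Eg' ming']; case: (ltngtP (h g) (h g')) => [lt|lt|/hinj//].
  by have := ming' g lt.
by have := ming g' lt.
Qed.

Lemma first_entry_ex x g : E (act g x) -> exists g', first_entry g' x.
Proof.
move=> Eg; have [n] : exists n, h g = n by exists (h g).
elim/ltn_ind: n g Eg => n IH g Eg hg.
have [[g' [lt Eg']]|no] := pselect (exists g', (h g' < h g)%N /\ E (act g' x)).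
  by apply: (IH (h g') _ g' Eg') => //; rewrite -hg.
by exists g; split=> // g' lt Eg'; apply: no; exists g'.
Qed.

Definition saturation : set X := [set x | exists g, E (act g x)].

Lemma measurable_saturation : measurable saturation.
Proof.
rewrite (_ : saturation = [set x | exists2 g, setT g & (act g @^-1` E) x]).
  apply: (measurable_exists cG) => g _.
  exact: (measurable_preimage (measurable_act hact g) mE).
by apply/seteqP; split=> x [g]; exists g.
Qed.

Lemma saturation_act k x : saturation (act k x) <-> saturation x.
Proof.
split=> [[g Eg]|[g Eg]]; first by exists (g * k)%g; rewrite (act_mul hact).
by exists (g * k^-1)%g; rewrite (act_mul hact) (actK hact).
Qed.

Lemma saturation_sub : E `<=` saturation.
Proof. by move=> x Ex; exists 1%g; rewrite (act_one hact). Qed.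

Definition entry (x : X) : G := xget 1%g [set g | first_entry g x].

Lemma entryP x : saturation x -> first_entry (entry x) x.
Proof.
move=> [g Eg]; have [g' Hg'] := first_entry_ex Eg.
by apply: (@xgetPex _ 1%g [set g | first_entry g x]); exists g'.
Qed.

Lemma entry_uniq x g : first_entry g x -> entry x = g.
Proof.
move=> Hg; have sx : saturation x by exists g; case: Hg.
exact: (first_entry_uniq (entryP sx) Hg).
Qed.

End FirstReturn.

(** * Part (ii): a Reiter sequence from almost invariant vectors *)

Section AlmostInvariantWeights.
Context {R : realType} {d} {X : measurableType d} {mu : probability X R}.
Context {G : groupType} (cG : countable [set: G]) {L : set G} (hL : is_subgroup L).
Context {act : G -> X -> X} (hact : pmp_action mu act).
Context {B : nat -> set X} (sB : point_separating B).
Context {E : set X} {mE : measurable E} {E0 : (0 < mu E)%E}.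
Context {h : G -> nat} (hinj : injective h).
Local Notation XE := (restr_space mE E0).
Local Notation val := (@restr_val _ _ _ _ _ mE E0).
Local Notation Q := (restr_rel mE E0 (orbit_rel act setT)).
Local Notation S := (restr_rel mE E0 (orbit_rel act L)).
Local Notation translate := (@translate _ _ _ _ _ act _ mE E0).
Local Notation coset_class := (@coset_class _ _ _ _ _ L act _ mE E0).
Local Notation normc := Normc.normc.
Local Notation Y := (@saturation _ _ G act E).
Local Notation T := (left_cosets L).
Local Notation first_entry := (@first_entry _ _ G act E h).
Local Notation entry := (@entry _ _ G act E h).

Context (xi : nat -> XE * set XE -> R[i]).
Context (mxi : forall n, quot_borel_fun (restr_prob mE E0) Q S (xi n)).
Context (aeg : {ae mu, forall x, good (L := L) (act := act) xi x}).

Definition base (x : X) : XE := to_restr point (act (entry x) x).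

Lemma baseE x : Y x -> val (base x) = act (entry x) x.
Proof. by move=> /(entryP (h := h)) [Ex _]; exact: to_restrE. Qed.

(** The vector |xi_n|^2 at [base x], pulled back to cosets by [coset_class x]; cosets with empty
    class, and points outside the saturation, get weight 0. *)
Definition weight n (a : T) (x : X) : R :=
  if pselect (Y x /\ coset_class x a !=set0) is left _
  then normc (xi n (base x, coset_class x a)) ^+ 2 else 0.

Lemma weight_ge0 n a x : 0 <= weight n a x.
Proof. by rewrite /weight; case: pselect => // _; exact: sqr_ge0. Qed.

Lemma weightE n a x : Y x -> coset_class x a !=set0 ->
  weight n a x = normc (xi n (base x, coset_class x a)) ^+ 2.
Proof. by rewrite /weight; case: pselect => // + ? ?; case. Qed.

Lemma weight0 n a x : ~ (Y x /\ coset_class x a !=set0) -> weight n a x = 0.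
Proof. by rewrite /weight; case: pselect. Qed.

Lemma measurable_class_normc n u :
  measurable_fun [set y : XE | E (act u (val y))]
    (fun y => normc (xi n (y, xsection S (translate u y))) ^+ 2).
Proof.
have mRe := measurable_class_fun hL hact sB (f := fun p => complex.Re (xi n p))
  (fun Z mZ => (mxi n mZ).1) (u := u).
have mIm := measurable_class_fun hL hact sB (f := fun p => complex.Im (xi n p))
  (fun Z mZ => (mxi n mZ).2) (u := u).
have := measurable_funD (measurable_funX 2 mRe) (measurable_funX 2 mIm).
apply: eq_measurable_fun => y _ /=.
by case: (xi n _) => s t /=; rewrite sqr_sqrtr// addr_ge0// sqr_ge0.
Qed.

(** Split by the entry element [g] of [x] and a representative [b] of [a] with [b^-1 x] in [E]. On
    each piece the class is that of the translate of [g x] by [b^-1 * g^-1], so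
    [measurable_class_normc] applies; the pieces are countably many. *)
Lemma measurable_weight n a : measurable_fun setT (weight n a).
Proof.
move=> _ Z mZ; rewrite setTI.
pose D u : set XE := [set y : XE | E (act u (val y))].
pose F u (y : XE) := normc (xi n (y, xsection S (translate u y))) ^+ 2.
pose dom := Y `&` [set x | coset_class x a !=set0].
have mdom : measurable dom.
  apply: measurableI; first exact: (measurable_saturation cG hact mE).
  exact: (measurable_coset_class_nonempty hact cG).
pose piece (p : G * G) := first_entry p.1 `&`
   ((fun x => to_restr (point : XE) (act p.1 x)) @^-1`
      (D (p.2^-1 * p.1^-1)%g `&` F (p.2^-1 * p.1^-1)%g @^-1` Z)).
have mpiece p : measurable (piece p).
  apply: measurableI; first exact: (measurable_first_entry cG hact mE).
  apply: measurable_preimage; last first.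
    exact: (measurable_class_normc n (measurable_translate_dom hact _) mZ).
  by apply: measurable_to_restr => //; exact: (measurable_act hact).
have cGG : countable [set: G * G] by rewrite -setXTT; exact: countableX.
rewrite (_ : _ @^-1` Z = [set x | exists2 p : G * G, set_val a p.2 & piece p x] `|`
    (~` dom `&` (cst 0 : X -> R) @^-1` Z)).
  apply: measurableU; first exact: (measurable_exists cGG).
  apply: measurableI; first exact: measurableC.
  exact: measurable_preimage.
have pieceE x g b : first_entry g x -> set_val a b -> E (act b^-1%g x) ->
    Y x /\ F (b^-1 * g^-1)%g (to_restr (point : XE) (act g x)) = weight n a x.
  move=> gx ab Eb; have [Eg _] := gx; have sx : Y x by exists g.
  have bx : act (b^-1 * g^-1)%g (act g x) = act b^-1%g x.
    by rewrite (act_mul hact) (actK hact).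
  have cl : coset_class x a (translate (b^-1 * g^-1)%g (base x)).
    exists b => //; rewrite translateE (baseE sx) (entry_uniq hinj gx) bx//.
  split=> //; rewrite weightE//; last by exists (translate (b^-1 * g^-1)%g (base x)).
  by rewrite (coset_class_xsection hL hact cl) /F /base (entry_uniq hinj gx).
apply/seteqP; split=> x /=.
  have [[sx ne]|nd] := pselect (dom x); last by rewrite weight0//; right.
  move=> Zw; left; have [y [b ab yb]] := ne; have ex := entryP (h := h) sx.
  have Eb : E (act b^-1%g x) by rewrite -yb; exact: restr_val_in.
  exists (entry x, b) => //; split=> //=; have [Eg _] := ex; split.
    by rewrite /D /= to_restrE// (act_mul hact) (actK hact).
  by rewrite /= (pieceE x (entry x) b ex ab Eb).2.
move=> [[[g b] /= ab [gx [/= Db FZ]]]|[nd Z0]].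
  have [Eg _] := gx; have Eb : E (act b^-1%g x).
    by move: Db; rewrite /D /= to_restrE// (act_mul hact) (actK hact).
  by rewrite -(pieceE x g b gx ab Eb).2.
by rewrite weight0.
Qed.

Lemma esum_coset_class (x : X) (y : XE) g (f : set XE -> \bar R) :
  (forall g', act g' x = x -> g' = 1%g) -> val y = act g x ->
  \esum_(c in subclasses Q S y) f c =
  \esum_(a in [set a | coset_class x a !=set0]) f (coset_class x a).
Proof.
move=> fx yE; rewrite (subclasses_coset_class hL hact yE) esum_image//.
exact: (coset_class_inj hL hact).
Qed.

Lemma base_actE x k : Y x -> val (base (act k x)) = act (entry (act k x) * k)%g x.
Proof.
move=> sx; rewrite baseE ?(act_mul hact)//.
exact/(saturation_act hact).
Qed.

(** Freeness enters here: since distinct cosets with nonempty class give distinct classes, summing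
    over cosets is summing over subclasses. *)
Lemma esum_weight n x : good (L := L) (act := act) xi x -> Y x ->
  \esum_(a in [set: T]) (weight n a x)%:E = 1%E.
Proof.
move=> [fx nrm _] sx; have /l2norm1 := nrm n _ _ (baseE sx).
rewrite (esum_coset_class _ fx (baseE sx)) => <-.
rewrite [RHS]esum_mkcond; apply: eq_esum => a _; case: ifPn.
  by rewrite inE => ne; rewrite weightE.
by rewrite notin_setE => ne; rewrite weight0// => -[].
Qed.

Definition weight_gap k n (x : X) : \bar R :=
  \esum_(a in [set: T]) `|weight n (coset_mul k a) (act k x) - weight n a x|%:E.

(** The coset [k a] at [k x] and the coset [a] at [x] name the same class, so only the base point
    changes, and both base points lie in one orbit. *)
Lemma weight_gapE k n x : good (L := L) (act := act) xi x -> Y x ->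
  weight_gap k n x = \esum_(c in subclasses Q S (base x))
    `|normc (xi n (base (act k x), c)) ^+ 2 - normc (xi n (base x, c)) ^+ 2|%:E.
Proof.
move=> [fx _ _] sx; rewrite (esum_coset_class _ fx (baseE sx)).
rewrite [RHS]esum_mkcond; apply: eq_esum => a _.
have ce : coset_class (act k x) (coset_mul k a) = coset_class x a.
  by rewrite (coset_class_act hact) coset_mulK.
have skx : Y (act k x) by apply/(saturation_act hact).
case: ifPn; first by rewrite inE => ne; rewrite !weightE// ce.
rewrite notin_setE => ne; rewrite !weight0 ?subrr ?normr0//; first by case.
by rewrite ce; case.
Qed.

Lemma esum_base_act n k x : good (L := L) (act := act) xi x -> Y x ->
  \esum_(c in subclasses Q S (base x)) (normc (xi n (base (act k x), c)) ^+ 2)%:E = 1%E.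
Proof.
move=> [fx nrm _] sx; have /l2norm1 := nrm n _ _ (base_actE k sx).
by rewrite !(esum_coset_class _ fx (base_actE k sx)) !(esum_coset_class _ fx (baseE sx)).
Qed.

Lemma cvg_weight_gap k x : good (L := L) (act := act) xi x -> Y x ->
  weight_gap k ^~ x @ \oo --> 0%E.
Proof.
move=> gx sx; have [_ _ cvgx] := gx.
have D0 n : (0 <= weight_gap k n x)%E.
  by apply: esum_ge0 => a _; rewrite lee_fin.
apply/(nonneg_cvg0P D0) => e e0.
have := cvgx _ _ _ _ (baseE sx) (base_actE k sx).
rewrite nonneg_cvg0P => [cv|n]; last exact: sqrte_ge0.
(* At l^2 distance at most [del], [esum_sqrB] with parameter [del] gives [del / 2 + 2 * del], which
   is below [4 * del = e]. *)
pose del := e / 4; have del0 : 0 < del by rewrite divr_gt0.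
have := cv _ del0; apply: filterS => n; rewrite l2norm_le ?(ltW del0)// => Dn.
rewrite weight_gapE//.
have n1 := esum_base_act n 1 gx sx; rewrite (act_one hact) in n1.
have n2 := esum_base_act n k gx sx.
apply: le_trans (esum_sqrB del0 n2 n1) _.
apply: (@le_trans _ _ ((2 * del)^-1%:E * (del ^+ 2)%:E + (2 * del)%:E)%E).
  have d2 : (0 <= ((2 * del)^-1)%:E)%E by rewrite lee_fin invr_ge0 mulr_ge0// ltW.
  rewrite leeD2r// lee_wpmul2l//.
  apply: le_trans Dn; apply: le_esum => c _; rewrite lee_fin.
  rewrite (_ : normc _ = normc (xi n (base x, c) - xi n (base (act k x), c)))//.
  by rewrite -(opprB (xi n (base x, c))); exact: (normcN (xi n (base x, c) - _)).
rewrite -EFinM -EFinD lee_fin.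
have -> : (2 * del)^-1 * del ^+ 2 = del / 2 by field; rewrite gt_eqF.
by rewrite /del; lra.
Qed.

(** Supplies the integrable bound for dominated convergence: two families of squares, each of sum
    1. *)
Lemma weight_gap_le2 k n x : good (L := L) (act := act) xi x -> (weight_gap k n x <= 2%:E)%E.
Proof.
move=> gx; have [sx|nsx] := pselect (Y x); last first.
  rewrite /weight_gap esum1 ?lee_fin// => a _.
  rewrite !weight0 ?subrr ?normr0//; first by case.
  by case=> /(saturation_act hact).
rewrite weight_gapE//.
have n1 := esum_base_act n 1 gx sx; rewrite (act_one hact) in n1.
have n2 := esum_base_act n k gx sx.
rewrite -[leRHS](_ : 1 + 1 = _)%E// -{1}n2 -n1 -esumD; do ?by move=> *; rewrite lee_fin sqr_ge0.
apply: le_esum => c _; rewrite -EFinD lee_fin.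
by apply: le_trans (ler_normB _ _) _; rewrite !ger0_norm ?sqr_ge0.
Qed.

Lemma weight_gap0 k n x : ~ Y x -> weight_gap k n x = 0%E.
Proof.
move=> nsx; rewrite /weight_gap esum1// => a _.
rewrite !weight0 ?subrr ?normr0//; first by case.
by case=> /(saturation_act hact).
Qed.

Let cT : countable [set: T]. Proof. exact: (countable_cosets hL cG). Qed.

Let mw n a : measurable_fun setT (fun x => (weight n a x)%:E).
Proof. by apply/measurable_EFinP; exact: measurable_weight. Qed.

Let mwk k n a : measurable_fun setT (weight n a \o act k).
Proof.
apply: measurableT_comp; last exact: (measurable_act hact k).
exact: measurable_weight.
Qed.

Let mgap k n a : measurable_fun setT
  (fun x => `|weight n (coset_mul k a) (act k x) - weight n a x|%:E).
Proof.
apply/measurable_EFinP; apply: measurableT_comp; first exact: normr_measurable.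
apply: measurable_funB; first exact: mwk.
exact: measurable_weight.
Qed.

Let measurable_weight_gap k n : measurable_fun setT (weight_gap k n).
Proof.
by apply: (measurable_esum cT) => [a x|a]; [rewrite lee_fin|exact: mgap].
Qed.

Let mY : measurable Y. Proof. exact: (measurable_saturation cG hact mE). Qed.

Let muY : R := fine (mu Y).

Let muYE : mu Y = muY%:E. Proof. by rewrite fineK// fin_num_measure. Qed.

Let muY_gt0 : 0 < muY.
Proof.
rewrite -lte_fin -muYE; apply: lt_le_trans E0 _.
by rewrite le_measure ?inE//; exact: (saturation_sub hact).
Qed.

Definition iweight n a : \bar R := (\int[mu]_x (weight n a x)%:E)%E.

Lemma iweight_ge0 n a : (0 <= iweight n a)%E.
Proof. by apply: integral_ge0 => x _; rewrite lee_fin weight_ge0. Qed.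

Lemma esum_iweight n : \esum_(a in [set: T]) iweight n a = muY%:E.
Proof.
rewrite -muYE -(setIT Y) -(integral_indic mu measurableT mY) /iweight.
have w0 a x : (0 <= (weight n a x)%:E)%E by rewrite lee_fin weight_ge0.
rewrite -(integral_esum cT _ measurableT w0 (mw n)).
apply: ge0_ae_eq_integral => //.
- exact: (measurable_esum cT).
- by apply/measurable_EFinP; exact: measurable_indic.
- by move=> x _; apply: esum_ge0.
apply: filterS aeg => x gx _; rewrite indicE.
have [sx|nsx] := pselect (Y x); first by rewrite mem_set// esum_weight.
rewrite memNset// esum1// => a _; rewrite weight0//; by case.
Qed.

Lemma iweight_fin n a : iweight n a \is a fin_num.
Proof.
rewrite ge0_fin_numE ?iweight_ge0//; apply: (@le_lt_trans _ _ muY%:E); last exact: ltry.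
rewrite -(esum_iweight n); apply: (@esum_ge1 _ _ _ (iweight n)) => // b _.
exact: iweight_ge0.
Qed.

(** Invariance of [mu] allows the integral of the weight of [k a] to be read at [k x], where it is
    close to the weight of [a] at [x]. *)
Lemma iweight_gap k n a :
  (`|fine (iweight n (coset_mul k a)) - fine (iweight n a)|%:E <=
   \int[mu]_x `|weight n (coset_mul k a) (act k x) - weight n a x|%:E)%E.
Proof.
have E1 : iweight n (coset_mul k a) = (\int[mu]_x (weight n (coset_mul k a) (act k x))%:E)%E.
  rewrite /iweight -(ge0_integral_preserving (measurable_act hact k)) => //.
  - by move=> A mA; exact: (act_preserves hact k mA).
  - by move=> x; rewrite lee_fin weight_ge0.
set J := (\int[mu]_x _)%E.
have le (u v : X -> R) : measurable_fun setT u -> measurable_fun setT v ->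
   (forall x, 0 <= u x) -> (forall x, 0 <= v x) ->
   (\int[mu]_x (u x)%:E <= (\int[mu]_x (v x)%:E) + (\int[mu]_x `|u x - v x|%:E))%E.
  move=> mu' mv u0 v0.
  have muv : measurable_fun setT (fun x => `|u x - v x|%:E).
    apply/measurable_EFinP; apply: measurableT_comp; first exact: normr_measurable.
    exact: measurable_funB.
  rewrite -ge0_integralD//; last 2 first.
  - by move=> x _; rewrite lee_fin.
  - exact/measurable_EFinP.
  apply: le_nnintegral => x; first by rewrite lee_fin.
  by rewrite -EFinD lee_fin -lerBlDl ler_norm.
have l1 : (iweight n (coset_mul k a) <= iweight n a + J)%E.
  rewrite E1; apply: (le _ _ (mwk k n _) (measurable_weight n a)).
    by move=> x; exact: weight_ge0.
  by move=> x; exact: weight_ge0.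
have l2 : (iweight n a <= iweight n (coset_mul k a) + J)%E.
  rewrite E1 /J; under [X in (_ + X)%E]eq_integral do rewrite distrC.
  apply: (le _ _ (measurable_weight n a) (mwk k n _)).
    by move=> x; exact: weight_ge0.
  by move=> x; exact: weight_ge0.
have J0 : (0 <= J)%E by apply: integral_ge0 => x _; rewrite lee_fin.
have [Joo|Jfin] := eqVneq J +oo%E; first by rewrite Joo leey.
have {}Jfin : J \is a fin_num by rewrite ge0_fin_numE// lt_neqAle Jfin leey.
rewrite -(fineK Jfin) lee_fin ler_distl lerBlDr -!lee_fin !EFinD !fineK ?iweight_fin//.
by rewrite l1 l2.
Qed.

Lemma cvg_integral_weight_gap k :
  (fun n => (\int[mu]_x weight_gap k n x)%E) @ \oo --> 0%E.
Proof.
have [||||_ _] := @dominated_convergence _ X R mu setT measurableT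
  (weight_gap k) (cst 0%E) (cst 2%:E) (measurable_weight_gap k).
- exact: measurable_cst.
- apply: filterS aeg => x gx _; have [sx|nsx] := pselect (Y x).
    exact: cvg_weight_gap.
  by under eq_fun do rewrite weight_gap0//; exact: cvg_cst.
- exact: finite_measure_integrable_cst.
- apply: filterS aeg => x gx n _; rewrite gee0_abs; first exact: weight_gap_le2.
  by apply: esum_ge0 => a _; rewrite lee_fin.
- by rewrite integral0.
Qed.

(** The integrated weights, divided by the measure of the saturation, are unit vectors. Their
    displacement by [k] is at most the normalised integral of [weight_gap k n], which tends to 0. *)
Lemma coamenable_of_almost_invariant : coamenable_subgroup R L.
Proof.
pose p n a := muY^-1 * fine (iweight n a).
have pi0 : 0 <= muY^-1 by rewrite invr_ge0 ltW.
apply: (@coamenable_of_reiter _ _ _ p).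
- by move=> n a; rewrite mulr_ge0// fine_ge0// iweight_ge0.
- move=> n; rewrite l1normZ ger0_norm//.
  rewrite (_ : l1norm _ = muY%:E); first by rewrite -EFinM mulVf// gt_eqF.
  rewrite -(esum_iweight n); apply: eq_esum => a _.
  by rewrite ger0_norm ?fine_ge0 ?iweight_ge0// fineK// iweight_fin.
- move=> k; apply: (@squeeze_cvge _ _ _ _ (cst 0%E) _
    (fun n => (muY^-1%:E * \int[mu]_x weight_gap k n x)%E)).
  + apply: nearW => n; rewrite l1norm_ge0/=.
    rewrite (_ : (fun _ => _) = fun a => muY^-1 *
      (fine (iweight n (coset_mul k a)) - fine (iweight n a))); last first.
      by apply/funext => a; rewrite /p mulrBr.
    rewrite l1normZ ger0_norm// lee_wpmul2l ?lee_fin//.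
    rewrite /weight_gap (integral_esum cT mu measurableT _ (mgap k n))//.
    by apply: le_esum => a _; exact: iweight_gap.
  + exact: cvg_cst.
  + rewrite -[X in _ --> X](mule0 muY^-1%:E); apply: cvgeZl => //.
    exact: cvg_integral_weight_gap.
Qed.

End AlmostInvariantWeights.

                                                                       

(** * Sums over fibres and distances between sums *)

Section EsumMore.
Context {R : realType}.
Local Open Scope ereal_scope.

Lemma esum_fibers (T C : choiceType) (D : T -> C) (A : set C) (f : T -> \bar R) :
  (forall a, 0 <= f a) ->
  \esum_(c in A) (\esum_(a in D @^-1` [set c]) f a) = \esum_(a in D @^-1` A) f a.
Proof.
move=> f0; rewrite (@esum_esum R C T A (fun c => D @^-1` [set c]) (fun c a => f a))//.
rewrite (@reindex_esum _ _ _ (D @^-1` A) _ (fun a => (D a, a)))//.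
split=> [a Aa /=|a b _ _ [] //|[c a] [/= Ac Dac]]; first by split.
by exists a; rewrite /= ?Dac.
Qed.

Lemma esum_subset (T : choiceType) (A B : set T) (f : T -> \bar R) :
  (forall a, 0 <= f a) -> A `<=` B -> \esum_(a in A) f a <= \esum_(a in B) f a.
Proof.
move=> f0 AB; rewrite esum_mkcond [leRHS]esum_mkcond; apply: le_esum => a _.
case: ifPn => [|_]; last by case: ifPn.
by rewrite inE => /AB Ba; rewrite mem_set.
Qed.

Lemma esum_absB (T : choiceType) (A : set T) (f g : T -> R) :
  (forall a, 0 <= f a)%R -> (forall a, 0 <= g a)%R ->
  \esum_(a in A) (f a)%:E <= (\esum_(a in A) (g a)%:E) + (\esum_(a in A) `|f a - g a|%:E).
Proof.
move=> f0 g0; rewrite -esumD; do ?by move=> *; rewrite lee_fin.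
by apply: le_esum => a _; rewrite -EFinD lee_fin -lerBlDl ler_norm.
Qed.

Lemma esum_dist (T : choiceType) (A : set T) (f g : T -> R) :
  (forall a, 0 <= f a)%R -> (forall a, 0 <= g a)%R ->
  \esum_(a in A) (f a)%:E \is a fin_num -> \esum_(a in A) (g a)%:E \is a fin_num ->
  `|fine (\esum_(a in A) (f a)%:E) - fine (\esum_(a in A) (g a)%:E)|%:E <=
  \esum_(a in A) `|f a - g a|%:E.
Proof.
move=> f0 g0 ffin gfin; set J := (X in _ <= X).
have J0 : 0 <= J by apply: esum_ge0 => a _; rewrite lee_fin.
have [Joo|Jfin] := eqVneq J +oo; first by rewrite Joo leey.
have {}Jfin : J \is a fin_num by rewrite ge0_fin_numE// lt_neqAle Jfin leey.
rewrite -(fineK Jfin) lee_fin ler_distl lerBlDr -!lee_fin !EFinD !fineK//.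
rewrite esum_absB// andbT; apply: le_trans (esum_absB A g0 f0) _.
by rewrite leeD2l// /J; apply: le_esum => a _; rewrite distrC.
Qed.

End EsumMore.

(** * Part (i): vectors on the quotient from weights on cosets *)

Section Construction.
Context {R : realType} {d} {X : measurableType d} {mu : probability X R}.
Context {G : groupType} (cG : countable [set: G]) {L : set G} (hL : is_subgroup L).
Context {act : G -> X -> X} (hact : pmp_action mu act).
Context {B : nat -> set X} (sB : point_separating B).
Context {E : set X} {mE : measurable E} {E0 : (0 < mu E)%E}.
Local Notation XE := (restr_space mE E0).
Local Notation val := (@restr_val _ _ _ _ _ mE E0).
Local Notation Q := (restr_rel mE E0 (orbit_rel act setT)).
Local Notation S := (restr_rel mE E0 (orbit_rel act L)).
Local Notation coset_class := (@coset_class _ _ _ _ _ L act _ mE E0).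
Local Notation normc := Normc.normc.
Local Notation T := (left_cosets L).

Context (P : nat -> T -> R) (P0 : forall N a, 0 <= P N a).
Context (Pfin : forall N, (l1norm (P N) < +oo)%E).

(** The [P N] are summable but not normalised: [mass] is the part of [P N] carried by cosets visible
    in [E], and [fiber_mass] its push-forward to classes. *)
Definition mass N (x : X) : \bar R :=
  \esum_(a in [set a | coset_class x a !=set0]) (P N a)%:E.

Definition fiber_mass N (x : X) (c : set XE) : \bar R :=
  \esum_(a in coset_class x @^-1` [set c]) (P N a)%:E.

Lemma sub_esum_fin N (A : set T) : \esum_(a in A) (P N a)%:E \is a fin_num.
Proof.
rewrite ge0_fin_numE; last by apply: esum_ge0 => a _; rewrite lee_fin.
apply: le_lt_trans (Pfin N).
apply: (@le_trans _ _ (\esum_(a in [set: T]) (P N a)%:E)).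
  by apply: esum_subset => // a; rewrite lee_fin.
by apply: le_esum => a _; rewrite lee_fin ler_norm.
Qed.

Lemma subclasses_preimage (y : XE) :
  coset_class (val y) @^-1` subclasses Q S y = [set a | coset_class (val y) a !=set0].
Proof.
rewrite (subclasses_coset_class hL hact (esym (act_one hact (val y)))).
by apply/seteqP; split=> a /=; [move=> [b nb <-]|move=> na; exists a].
Qed.

Lemma esum_fiber_mass N (y : XE) :
  \esum_(c in subclasses Q S y) fiber_mass N (val y) c = mass N (val y).
Proof.
rewrite /fiber_mass esum_fibers ?subclasses_preimage// => a.
by rewrite lee_fin.
Qed.

Definition rmass N x : R := fine (mass N x).
Definition rfiber_mass N x c : R := fine (fiber_mass N x c).

Lemma rmassE N x : (rmass N x)%:E = mass N x.
Proof. by rewrite fineK// sub_esum_fin. Qed.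

Lemma rfiber_massE N x c : (rfiber_mass N x c)%:E = fiber_mass N x c.
Proof. by rewrite fineK// sub_esum_fin. Qed.

Lemma rmass_ge0 N x : 0 <= rmass N x.
Proof. by apply/fine_ge0/esum_ge0 => a _; rewrite lee_fin. Qed.

Lemma rfiber_mass_ge0 N x c : 0 <= rfiber_mass N x c.
Proof. by apply/fine_ge0/esum_ge0 => a _; rewrite lee_fin. Qed.

                                                                             
                    
(** The square root of the normalised push-forward of [P N]. Where the mass vanishes, the indicator
    of the class of the point itself is used, so that the vector has norm 1 everywhere. *)
Definition amplitude N (p : XE * set XE) : R :=
  if 0 < rmass N (val p.1) then Num.sqrt (rfiber_mass N (val p.1) p.2 / rmass N (val p.1))
  else (p.2 == xsection S p.1)%:R.

Definition amplitudeC N (p : XE * set XE) : R[i] := (amplitude N p)%:C%C.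

Lemma amplitude_norm N (y : XE) :
  l2norm (subclasses Q S y) (fun c => amplitudeC N (y, c)) = 1%E.
Proof.
apply/l2norm1.
under eq_esum do rewrite normc_real real_normK ?num_real//.
rewrite /amplitude /=; have [W0|_] := boolP (0 < rmass N (val y)).
  under eq_esum do rewrite sqr_sqrtr ?divr_ge0 ?rfiber_mass_ge0 ?rmass_ge0// mulrC EFinM.
  rewrite esumZl; last 2 first.
  - by rewrite invr_ge0 ltW.
  - by move=> c; rewrite lee_fin rfiber_mass_ge0.
  under eq_esum do rewrite rfiber_massE.
  by rewrite esum_fiber_mass -rmassE -EFinM mulVf// gt_eqF.
rewrite (_ : (fun _ => _) = fun c => if c \in [set xsection S y] then 1%E else 0%E :> \bar R).
  rewrite -esum_mkcondr setIC (_ : _ `&` _ = [set xsection S y]) ?esum_set1//.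
  apply/seteqP; split=> c; first by case.
  move=> /= ->; split=> //; exists y => //.
  by apply/(xsection_orbitP (act := act)); exists 1%g; rewrite (act_one hact).
apply/funext => c; have [->|cy] := eqVneq c (xsection S y).
  by rewrite expr1n mem_set.
by rewrite expr0n memNset//; exact/eqP.
Qed.

Lemma measurable_fiber_mass N (gam : XE -> XE) : measurable_fun setT gam ->
  measurable_fun setT (fun y => rfiber_mass N (val y) (xsection S (gam y))).
Proof.
move=> mgam.
pose M a : set XE := [set y : XE | coset_class (val y) a = xsection S (gam y)].
have mM a : measurable (M a) by exact: (measurable_class_eq hL hact sB cG).
have fE y : fiber_mass N (val y) (xsection S (gam y)) =
    \esum_(a in [set: T]) (P N a * \1_(M a) y)%:E.
  rewrite /fiber_mass esum_mkcond; apply: eq_esum => a _; rewrite indicE.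
  case: ifPn; first by rewrite inE /= => e; rewrite mem_set// mulr1.
  by rewrite notin_setE /= => e; rewrite memNset// mulr0.
rewrite (_ : (fun _ => _) = fine \o (fun y => \esum_(a in [set: T]) (P N a * \1_(M a) y)%:E)).
  apply: measurableT_comp; first exact: (@fine_measurable R setT).
  apply: (measurable_esum (countable_cosets hL cG)) => [a y|a]; first by rewrite lee_fin mulr_ge0.
  apply/measurable_EFinP; apply: measurable_funM; first exact: measurable_cst.
  exact: measurable_indic.
by apply/funext => y /=; rewrite /rfiber_mass fE.
Qed.

Lemma mass_indic N x : mass N x =
  \esum_(a in [set: T]) (P N a * \1_[set x | coset_class x a !=set0] x)%:E.
Proof.
rewrite /mass esum_mkcond; apply: eq_esum => a _; rewrite indicE.
case: ifPn; first by rewrite inE /= => e; rewrite mem_set// mulr1.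
by rewrite notin_setE /= => e; rewrite memNset// mulr0.
Qed.

Lemma measurable_mass N : measurable_fun setT (mass N).
Proof.
rewrite (funext (mass_indic N)).
apply: (measurable_esum (countable_cosets hL cG)) => [a y|a].
  by rewrite lee_fin mulr_ge0.
apply/measurable_EFinP; apply: measurable_funM; first exact: measurable_cst.
by apply: measurable_indic; exact: (measurable_coset_class_nonempty hact cG).
Qed.

Lemma measurable_amplitude N (gam : XE -> XE) : measurable_fun setT gam ->
  measurable_fun setT (fun y => amplitude N (y, xsection S (gam y))).
Proof.
move=> mgam; have mW : measurable_fun setT (fun y : XE => rmass N (val y)).
  apply: (@measurableT_comp _ _ _ _ _ _ (rmass N)); last exact: measurable_restr_val.
  apply: (@measurableT_comp _ _ _ _ _ _ fine); first exact: fine_measurable.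
  exact: measurable_mass.
rewrite /amplitude /=; apply: measurable_fun_ifT => /=.
- apply: (measurable_fun_bool true); rewrite setTI.
  rewrite (_ : _ @^-1` _ = (fun y : XE => rmass N (val y)) @^-1` `]0, +oo[).
    by apply: measurable_preimage => //; exact: measurable_itv.
  by apply/seteqP; split=> y /=; rewrite in_itv/= andbT.
- rewrite (_ : (fun _ => _) = fun y => powR (rfiber_mass N (val y) (xsection S (gam y)) *
      powR (rmass N (val y)) (-1)) 2^-1).
    apply: (measurableT_comp (measurable_powR 2^-1)); apply: measurable_funM.
      exact: measurable_fiber_mass.
    exact: (measurableT_comp (measurable_powR (-1))).
  apply/funext => y; rewrite powR_inv1 ?rmass_ge0// powR12_sqrt//.
  by rewrite divr_ge0 ?rfiber_mass_ge0 ?rmass_ge0.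
(* The coset of the identity always names the class of [y] itself, so the default value is the
   indicator of a set covered by [measurable_class_eq]. *)
- have [a a1] := coset_ex hL 1%g.
  have cl y : coset_class (val y) a = xsection S y.
    by apply: coset_class_xsection => //; exists 1%g => //; rewrite invg1 (act_one hact).
  rewrite (_ : (fun _ => _) = \1_[set y : XE | coset_class (val y) a = xsection S (gam y)]).
    by apply: measurable_indic; exact: (measurable_class_eq hL hact sB cG).
  apply/funext => y; rewrite indicE; congr (_ %:R); congr nat_of_bool.
  apply/eqP/idP; first by move=> e; rewrite mem_set//= cl e.
  by rewrite inE /= cl.
Qed.

Lemma amplitude_quot_L2 N : quot_L2 (restr_prob mE E0) Q S (amplitudeC N).
Proof.
have norm1 y := (l2norm1 _ _).1 (amplitude_norm N y).
split; last first.
  rewrite /quot_integral; under eq_integral do rewrite norm1.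
  by rewrite integral_cst// mul1e; rewrite (le_lt_trans (probability_le1 _ _))// ltry.
have msub (F : R -> Prop) (gam : XE -> XE) : measurable_fun setT gam -> measurable [set t | F t] ->
    measurable [set y | (quot_rel Q S `&` [set p | F (amplitude N p)]) (y, xsection S (gam y))].
  move=> mgam mF.
  rewrite (_ : mkset _ = [set y | Q (y, gam y)] `&`
    (fun y => amplitude N (y, xsection S (gam y))) @^-1` [set t | F t]).
    apply: measurableI; first exact: (measurable_orbit hact sB cG).
    by apply: measurable_preimage => //; exact: measurable_amplitude.
  by apply/seteqP; split=> y [] /(quot_rel_orbit hL hact).
move=> Y mY; split; split=> [|gam [_ mgam _ _]]; do ?by move=> ? [].
  exact: msub.
apply: (msub (fun=> Y 0)) => //=.
have [Y0|nY0] := pselect (Y 0); last by rewrite (_ : mkset _ = set0)//; apply/seteqP; split.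
by rewrite (_ : mkset _ = setT)//; apply/seteqP; split.
Qed.

Definition gap N k : \bar R := l1norm (fun a => P N (coset_mul k a) - P N a).

(** Equivariance of [coset_class]: moving the base point by [k] translates the weights by [k], so
    both kinds of mass vary by at most [gap N k]. *)
Lemma esum_coset_shift N k x (A : set (set XE)) :
  \esum_(a in coset_class (act k x) @^-1` A) (P N a)%:E =
  \esum_(a in coset_class x @^-1` A) (P N (coset_mul k a))%:E.
Proof.
apply: reindex_esum.
have ck a : coset_class (act k x) (coset_mul k a) = coset_class x a.
  by rewrite (coset_class_act hact) coset_mulK.
split=> [a /=|a b _ _|a /= Aa]; first by rewrite ck.
  by move/(can_inj (coset_mulK (L := L) k)).
exists (coset_mul k^-1%g a); last by rewrite coset_mulVK.
by rewrite /= -ck coset_mulVK.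
Qed.

Lemma shift_dist N k x (A : set (set XE)) :
  (`|fine (\esum_(a in coset_class (act k x) @^-1` A) (P N a)%:E) -
     fine (\esum_(a in coset_class x @^-1` A) (P N a)%:E)|%:E <=
   \esum_(a in coset_class x @^-1` A) `|P N (coset_mul k a) - P N a|%:E)%E.
Proof.
rewrite esum_coset_shift; apply: esum_dist => //.
  by rewrite -esum_coset_shift sub_esum_fin.
exact: sub_esum_fin.
Qed.

Lemma mass_dist N k x : (`|rmass N (act k x) - rmass N x|%:E <= gap N k)%E.
Proof.
apply: le_trans (shift_dist N k x [set c | c !=set0]) _.
by apply: esum_subset => // a; rewrite lee_fin.
Qed.

Lemma fiber_mass_dist N k (y : XE) :
  (\esum_(c in subclasses Q S y)
     `|rfiber_mass N (act k (val y)) c - rfiber_mass N (val y) c|%:E <= gap N k)%E.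
Proof.
apply: (@le_trans _ _ (\esum_(c in subclasses Q S y)
    (\esum_(a in coset_class (val y) @^-1` [set c]) `|P N (coset_mul k a) - P N a|%:E))).
  by apply: le_esum => c _; exact: shift_dist.
rewrite esum_fibers; last by move=> a; rewrite lee_fin.
by apply: esum_subset => // a; rewrite lee_fin.
Qed.

Lemma sqrt_sqrB (s t : R) : 0 <= s -> 0 <= t ->
  (Num.sqrt s - Num.sqrt t) ^+ 2 <= `|s - t|.
Proof.
move=> s0 t0; rewrite -{2}(sqr_sqrtr s0) -{2}(sqr_sqrtr t0) subr_sqr normrM.
have a0 := sqrtr_ge0 s; have b0 := sqrtr_ge0 t.
rewrite -real_normK ?num_real// expr2 ler_wpM2l//.
rewrite [leRHS]ger0_norm ?addr_ge0//.
by rewrite ler_norml; apply/andP; split; lra.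
Qed.

(** The denominators are at least 1, so dividing does not amplify the errors. The factor [V^-1 * v]
    is kept because its sum over classes is 1. *)
Lemma ratio_dist (u U v V : R) : 0 <= v -> 1 <= U -> 1 <= V ->
  `|u / U - v / V| <= `|u - v| + `|V - U| * (V^-1 * v).
Proof.
move=> v0 U1 V1; have U0 : 0 < U by lra. have V0 : 0 < V by lra.
have -> : u / U - v / V = (u - v) / U + ((V - U) * (V^-1 * v)) / U.
  by field; rewrite !gt_eqF.
have iU : `|U^-1| <= 1 by rewrite normfV invf_le1 ?normr_gt0 ?gt_eqF// ger0_norm// ltW.
have q0 : 0 <= V^-1 * v by rewrite mulr_ge0// invr_ge0 ltW.
move: (V^-1 * v) q0 => q q0.
apply: le_trans (ler_normD _ _) _; rewrite !normrM (ger0_norm q0).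
apply: lerD; rewrite -[leRHS]mulr1 ler_wpM2l//.
exact: mulr_ge0.
Qed.

(** By [sqrt_sqrB] the squared distance is at most the l^1 distance of the normalised masses; by
    [ratio_dist] the numerators and the denominators contribute one [gap N k] each. *)
Lemma amplitude_dist N k (y z : XE) : val z = act k (val y) ->
  1 <= rmass N (val y) -> 1 <= rmass N (val z) ->
  (\esum_(c in subclasses Q S y) (normc (amplitudeC N (y, c) - amplitudeC N (z, c)) ^+ 2)%:E
   <= gap N k + gap N k)%E.
Proof.
move=> zE y1 z1; have y0 : 0 < rmass N (val y) by lra. have z0 : 0 < rmass N (val z) by lra.
have yz : subclasses Q S y = subclasses Q S z.
  rewrite (subclasses_coset_class hL hact zE).
  by rewrite (subclasses_coset_class hL hact (esym (act_one hact (val y)))).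
apply: (@le_trans _ _ (\esum_(c in subclasses Q S y)
    ((`|rfiber_mass N (val z) c - rfiber_mass N (val y) c|)%:E +
     (`|rmass N (val z) - rmass N (val y)|)%:E *
       ((rmass N (val z))^-1 * rfiber_mass N (val z) c)%:E)%E)).
  apply: le_esum => c _; rewrite -EFinM -EFinD lee_fin.
  rewrite /amplitudeC -rmorphB normc_real real_normK ?num_real// /amplitude /= y0 z0.
  apply: le_trans (sqrt_sqrB _ _) _; rewrite ?divr_ge0 ?rfiber_mass_ge0 ?rmass_ge0//.
  by rewrite (distrC (rfiber_mass N (val z) c)); apply: ratio_dist => //; exact: rfiber_mass_ge0.
have p0 c : 0 <= (rmass N (val z))^-1 * rfiber_mass N (val z) c.
  by rewrite mulr_ge0 ?invr_ge0 ?rmass_ge0 ?rfiber_mass_ge0.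
rewrite esumD; last 2 first.
- by move=> c _; rewrite lee_fin.
- by move=> c _; rewrite -EFinM lee_fin mulr_ge0.
rewrite esumZl//.
have -> : \esum_(c in subclasses Q S y) ((rmass N (val z))^-1 * rfiber_mass N (val z) c)%:E = 1%E.
  under eq_esum do rewrite EFinM.
  rewrite esumZl; last 2 first.
  - by rewrite invr_ge0 ltW.
  - by move=> c; rewrite lee_fin rfiber_mass_ge0.
  under eq_esum do rewrite rfiber_massE.
  by rewrite yz esum_fiber_mass -rmassE -EFinM mulVf// gt_eqF.
by rewrite mule1 leeD// zE ?fiber_mass_dist ?mass_dist.
Qed.

Lemma coamenable_of_mass : (forall k, gap ^~ k @ \oo --> 0%E) ->
  {ae mu, forall x, E x -> \forall N \near \oo, (1 <= mass N x)%E} ->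
  coamenable (restr_prob mE E0) Q S.
Proof.
move=> gap0 aem; exists amplitudeC; split.
- exact: amplitude_quot_L2.
- by move=> N; apply: aeW => y; exact: amplitude_norm.
have : {ae mu, forall x, forall g, E (act g x) -> \forall N \near \oo, (1 <= mass N (act g x))%E}.
  apply: (ae_countable (mu := mu)) => // g.
  apply: (ae_preimage (P := fun x => E x -> \forall N \near \oo, (1 <= mass N x)%E)) => //.
    exact: (measurable_act hact g).
  by move=> A mA; exact: (act_preserves hact g mA).
move=> [Z [mZ Z0 badZ]].
pose Z' : set XE := val @^-1` Z.
have mZ' : measurable Z' by exact: (measurable_preimage (@measurable_restr_val _ _ _ _ _ mE E0) mZ).
have Z'0 : restr_prob mE E0 Z' = 0%E.
  apply/(restr_prob_null mE E0 mZ); apply/eqP; rewrite eq_le measure_ge0 andbT -Z0.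
  by rewrite le_measure ?inE//; exact: measurableI.
(* Off [Z'] the sections of this set are empty, so its relation measure is the integral of a
   function supported on a null set. *)
exists (fst @^-1` Z'); split.
- exact: (measurable_preimage measurable_fst mZ').
- apply: (nnintegral_support_null mZ' Z'0) => y.
    by rewrite /counting; case: ifPn; rewrite ?leey// => _; rewrite lee_fin.
  move=> nZ; rewrite (_ : xsection _ _ = set0) ?counting0//.
  by apply/seteqP; split=> z //; rewrite /xsection /= inE => -[].
- move=> [y z] /= bad; apply: badZ => /= good; apply: bad => Qyz.
  have /(orbitP (act := act)) [k zE] := Qyz.
  have gy : \forall N \near \oo, (1 <= mass N (val y))%E.
    have := good 1%g; rewrite (act_one hact); apply; exact: restr_val_in.
  have gz : \forall N \near \oo, (1 <= mass N (val z))%E.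
    by have := good k; rewrite -zE; apply; exact: restr_val_in.
  apply/nonneg_cvg0P => [N|e e0]; first exact: sqrte_ge0.
  (* [amplitude_dist] bounds the square of the norm by twice the gap, whence the threshold
     [e ^+ 2 / 2]. *)
  have e2 : 0 < e ^+ 2 / 2 by rewrite divr_gt0// exprn_gt0.
  have gk : \forall N \near \oo, (gap N k <= (e ^+ 2 / 2)%:E)%E.
    exact: ((nonneg_cvg0P (fun N => l1norm_ge0 _)).1 (gap0 k) _ e2).
  apply: filterS3 gy gz gk => N; rewrite -!rmassE !lee_fin => y1 z1 gN.
  rewrite l2norm_le ?(ltW e0)//; apply: le_trans (amplitude_dist zE y1 z1) _.
  by rewrite [e ^+ 2]splitr EFinD leeD.
Qed.

End Construction.

(** * Series of nonnegative extended reals *)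

Section Series.
Context {R : realType}.
Local Open Scope ereal_scope.

Lemma nneseries_le (u : nat -> \bar R) N x : (forall n, 0 <= u n) ->
  (forall n, \sum_(N <= i < n) u i <= x) -> \sum_(N <= i <oo) u i <= x.
Proof.
move=> u0 ux; apply: lime_le; first by apply: is_cvg_nneseries => *.
exact: nearW.
Qed.

Lemma nneseries_half : \sum_(0 <= n <oo) ((2^-1 ^+ n)%R)%:E < +oo :> \bar R.
Proof.
apply: (@le_lt_trans _ _ 2%:E); last exact: ltry.
have h0 n : (0 <= 2^-1 ^+ n :> R)%R by rewrite exprn_ge0// invr_ge0.
apply: nneseries_le => [n|n]; first by rewrite lee_fin.
suff -> : \sum_(0 <= i < n) (2^-1 ^+ i)%:E = (2 - 2 * 2^-1 ^+ n)%R%:E :> \bar R.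
  by rewrite lee_fin gerBl mulr_ge0.
elim: n => [|n ih]; first by rewrite big_geq// expr0 mulr1 subrr.
by rewrite big_nat_recr//= ih -EFinD; congr EFin; rewrite exprS; field.
Qed.

Lemma nneseries_eventually (u v : nat -> \bar R) N : (forall n, 0 <= u n) ->
  (forall n, u n < +oo) -> (forall n, (N <= n)%N -> u n <= v n) ->
  (forall n, 0 <= v n) -> \sum_(0 <= n <oo) v n < +oo ->
  \sum_(0 <= n <oo) u n < +oo.
Proof.
move=> u0 ufin uv v0 vfin; rewrite (nneseries_split 0 N)//.
apply: lte_add_pinfty; first exact: lte_sum_pinfty.
apply: le_lt_trans vfin.
apply: (@le_trans _ _ (\sum_(N <= n <oo) v n)).
  rewrite add0n; apply: nneseries_le => // n.
  apply: (@le_trans _ _ (\sum_(N <= i < n) v i)).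
    rewrite big_nat_cond [leRHS]big_nat_cond; apply: lee_sum => i /andP[/andP[Ni _] _].
    exact: uv.
  exact: nneseries_lim_ge.
by rewrite [leRHS](nneseries_split 0 N)// add0n leeDr// sume_ge0.
Qed.

Lemma nneseries_term_cvg0 (u : nat -> \bar R) : (forall n, 0 <= u n) ->
  \sum_(0 <= n <oo) u n < +oo -> u @ \oo --> 0.
Proof.
move=> u0 ufin; have tl := nneseries_tail_cvg (P := xpredT) ufin (fun n _ => u0 n).
apply: (squeeze_cvge _ (cvg_cst 0) tl); apply: nearW => n; rewrite u0/=.
have := @nneseries_lim_ge _ u xpredT n n.+1 (fun i _ _ => u0 i).
by rewrite big_nat1.
Qed.

End Series.

(** * Part (i): windows of a Reiter sequence see almost every point of E *)

Section Windows.
Context {R : realType} {d} {X : measurableType d} {mu : probability X R}.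
Context {G : groupType} (cG : countable [set: G]) {L : set G} (hL : is_subgroup L).
Context {act : G -> X -> X} (hact : pmp_action mu act).
Context {B : nat -> set X} (sB : point_separating B).
Context {E : set X} {mE : measurable E} {E0 : (0 < mu E)%E}.
Local Notation XE := (restr_space mE E0).
Local Notation val := (@restr_val _ _ _ _ _ mE E0).
Local Notation Q := (restr_rel mE E0 (orbit_rel act setT)).
Local Notation S := (restr_rel mE E0 (orbit_rel act L)).
Local Notation coset_class := (@coset_class _ _ _ _ _ L act _ mE E0).
Local Notation T := (left_cosets L).
Local Notation mass := (@mass _ _ _ _ _ L act _ mE E0).
Local Notation rmass := (@rmass _ _ _ _ _ L act _ mE E0).

Context (p : nat -> T -> R) (p0 : forall n a, 0 <= p n a).
Context (p1 : forall n, l1norm (p n) = 1%E).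
Context (peps : forall g, exists n0, forall n, (n0 <= n)%N ->
   (l1norm (fun a => p n (coset_mul g a) - p n a)%R <= (2^-1 ^+ n)%:E)%E).

Let pfin n : (l1norm (p n) < +oo)%E. Proof. by rewrite p1 ltry. Qed.

Let mass0 n x : (0 <= mass p n x)%E.
Proof. by apply: esum_ge0 => a _; rewrite lee_fin. Qed.

Let gap0 n k : (0 <= gap p n k)%E. Proof. exact: l1norm_ge0. Qed.

Lemma mass_le1 n x : (mass p n x <= 1)%E.
Proof.
rewrite -(p1 n); apply: (@le_trans _ _ (\esum_(a in [set: T]) (p n a)%:E)).
  by apply: esum_subset => // a; rewrite lee_fin.
by apply: le_esum => a _; rewrite lee_fin ler_norm.
Qed.

Lemma mass_act n k x : (mass p n (act k x) <= mass p n x + gap p n k)%E.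
Proof.
apply: le_trans (_ : (mass p n x + `|rmass p n (act k x) - rmass p n x|%:E <= _)%E).
  rewrite -!(rmassE p0 pfin) -EFinD lee_fin -lerBlDl; exact: ler_norm.
rewrite leeD2l//; exact: (mass_dist hact p0 pfin).
Qed.

Lemma gap_fin n k : (gap p n k < +oo)%E.
Proof.
apply: le_lt_trans (l1normD (p n \o coset_mul k) (fun a => - p n a)) _.
rewrite lte_add_pinfty//.
  by rewrite (l1norm_comp (t := fun _ : 'I_1 => coset_mul k^-1%g)
    (s := fun _ : 'I_1 => coset_mul k) _ _ _ ord0) => // _; [exact: coset_mulK|exact: coset_mulVK].
by apply: le_lt_trans (pfin n); apply: le_l1norm => a; rewrite normrN.
Qed.

Lemma sum_gap_fin k : (\sum_(0 <= n <oo) gap p n k < +oo)%E.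
Proof.
have [n0 h] := peps k.
apply: (nneseries_eventually (v := fun n => (2^-1 ^+ n)%:E) (N := n0)) => //.
- by move=> n; exact: gap_fin.
- exact: nneseries_half.
Qed.

Definition total_mass x : \bar R := (\sum_(0 <= n <oo) mass p n x)%E.

(** The points at which no choice of windows could keep the mass at least 1. *)
Definition transient : set X := [set x | (total_mass x < +oo)%E].

Lemma measurable_transient : measurable transient.
Proof.
rewrite (_ : transient = ~` (total_mass @^-1` [set +oo%E])).
  apply: measurableC; apply: measurable_preimage; last exact: emeasurable_set1.
  apply: (@ge0_emeasurable_sum _ _ R setT (mass p) xpredT) => // n _.
  exact: (measurable_mass cG hL hact p0).
apply/seteqP; split=> x /=; rewrite /transient /= ltey; first by move/eqP.
by move=> h; apply/eqP.
Qed.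

(** Moving by [k] changes the n-th mass by at most [gap p n k], and these gaps are summable over
    n. *)
Lemma transient_act k x : transient x -> transient (act k x).
Proof.
rewrite /transient /= => sx; apply: (@le_lt_trans _ _ (total_mass x + \sum_(0 <= n <oo) gap p n k)%E).
  rewrite /total_mass -nneseriesD//; apply: lee_nneseries => // n _; exact: mass_act.
by rewrite lte_add_pinfty// sum_gap_fin.
Qed.

(** By invariance of [mu] and of the transient set, the points seeing the coset [a] have the same
    measure for every [a], namely that for the trivial coset; averaging this constant against [p n]
    leaves it unchanged. *)
Lemma integral_mass (a0 : T) n : set_val a0 1%g ->
  ((\int[mu]_(x in transient) mass p n x) =
   mu ([set x | coset_class x a0 !=set0] `&` transient))%E.
Proof.
move=> a01; set c := mu _.
pose M a : set X := [set x | coset_class x a !=set0].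
have mM a : measurable (M a) by exact: (measurable_coset_class_nonempty hact cG).
have mF := measurable_transient.
have Mc a : mu (M a `&` transient) = c.
  have [g ag] := coset_nonempty hL a.
  transitivity (mu (act g^-1%g @^-1` (M a0 `&` transient))); last first.
    by apply: (act_preserves hact); exact: measurableI.
  congr (mu _); apply/seteqP; split=> x /= [].
    move=> ne tx; split; last exact: transient_act.
    rewrite /M /= (coset_class_act hact) invgK.
    suff -> : coset_mul g a0 = a by [].
    by apply: (coset_eq hL _ ag); exists 1%g => //; rewrite mulg1.
  move=> ne /(transient_act g); rewrite (actVK hact) => tx; split=> //.
  move: ne; rewrite /M /= (coset_class_act hact) invgK.
  suff -> : coset_mul g a0 = a by [].
  by apply: (coset_eq hL _ ag); exists 1%g => //; rewrite mulg1.
have massE x : mass p n x = \esum_(a in [set: T]) ((p n a)%:E * (\1_(M a) x)%:E)%E.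
  exact: mass_indic.
under eq_integral do rewrite massE.
have f0 a x : (0 <= (p n a)%:E * (\1_(M a) x)%:E)%E by rewrite mule_ge0 ?lee_fin.
have mf a : measurable_fun transient (fun x => ((p n a)%:E * (\1_(M a) x)%:E)%E).
  rewrite (_ : (fun _ => _) = fun x => (p n a * \1_(M a) x)%:E)//.
  apply/measurable_EFinP; apply: measurable_funM; first exact: measurable_cst.
  exact: measurable_indic.
rewrite (integral_esum (countable_cosets hL cG) mu mF f0 mf).
transitivity (\esum_(a in [set: T]) (c * (p n a)%:E)%E).
  apply: eq_esum => a _; rewrite ge0_integralZl_EFin//; last first.
    by apply/measurable_EFinP; exact: measurable_indic.
  by rewrite (integral_indic mu mF (mM a)) [X in (_ * X)%E](Mc a) muleC.
have cfin : c \is a fin_num by apply: fin_num_measure; exact: (measurableI _ _ (mM a0) mF).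
have c0 : (0 <= c)%E by exact: measure_ge0.
rewrite -(fineK cfin) esumZl ?fine_ge0//; last by move=> a; rewrite lee_fin.
rewrite (_ : esum _ _ = 1%E) ?mule1// -(p1 n).
by apply: eq_esum => a _; rewrite ger0_norm.
Qed.

(** On the transient set the masses are terms of a convergent series bounded by 1, so their
    integrals tend to 0. By [integral_mass] they are constant, hence 0, and points of [E] see the
    trivial coset. *)
Lemma transient_null : mu (E `&` transient) = 0%E.
Proof.
have [a0 a01] := coset_ex hL 1%g.
have mF := measurable_transient.
have mM : measurable [set x | coset_class x a0 !=set0].
  exact: (measurable_coset_class_nonempty hact cG).
apply/eqP; rewrite eq_le measure_ge0 andbT.
apply: (@le_trans _ _ (mu ([set x | coset_class x a0 !=set0] `&` transient))).
  rewrite le_measure ?inE//; do ?exact: measurableI.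
  apply: setSI => x Ex; exists (to_restr point x), 1%g => //.
  by rewrite invg1 (act_one hact) to_restrE.
have [||||_ _] := @dominated_convergence _ X R mu transient mF (mass p) (cst 0%E) (cst 1%E)
    (fun n => measurable_funTS (measurable_mass cG hL hact p0 n)).
- exact: measurable_cst.
- by apply: aeW => x tx; exact: nneseries_term_cvg0.
- exact: (finite_measure_integrable_cst mu 1 mF).
- by apply: aeW => x n _; rewrite gee0_abs// mass_le1.
rewrite integral0; under eq_fun do rewrite (integral_mass _ a01).
by move=> /(cvg_unique (@ereal_hausdorff R) (cvg_cst _)) ->.
Qed.

Definition window N M x : \bar R := (\sum_(N <= n < M) mass p n x)%E.

Definition low_window N M : set X := E `&` [set x | (window N M x < 1)%E].

Lemma measurable_low_window N M : measurable (low_window N M).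
Proof.
apply: measurableI => //.
rewrite (_ : mkset _ = window N M @^-1` `]-oo, 1%E[%classic); last first.
  by apply/seteqP; split=> x /=; rewrite in_itv.
apply: measurable_preimage; last exact: emeasurable_itv.
apply: emeasurable_sum => n; exact: (measurable_mass cG hL hact p0).
Qed.

(** For fixed [N] the low windows decrease as [M] grows, and a point in all of them has finite total
    mass, so continuity from above and [transient_null] apply. *)
Lemma low_window_small N : exists M, (mu (low_window N M) <= (2^-1 ^+ N)%:E)%E.
Proof.
have mcap : measurable (\bigcap_M low_window N M).
  by apply: bigcap_measurable => // M _; exact: measurable_low_window.
have m0 : mu (\bigcap_M low_window N M) = 0%E.
  apply/eqP; rewrite eq_le measure_ge0 andbT -transient_null le_measure ?inE//.
    by apply: measurableI => //; exact: measurable_transient.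
  move=> x wx; split; first by have [] := wx 0%N I.
  rewrite /transient /= /total_mass (nneseries_split 0 N)// add0n lte_add_pinfty//.
    apply: lte_sum_pinfty => n _; apply: le_lt_trans (mass_le1 n x) _; exact: ltry.
  apply: (@le_lt_trans _ _ 1%E); last exact: ltry.
  by apply: nneseries_le => // M; have [_ /ltW] := wx M I.
have cv : (fun M => mu (low_window N M)) @ \oo --> 0%E.
  rewrite -m0; apply: nonincreasing_cvg_mu => //.
  - exact: le_lt_trans (probability_le1 mu (measurable_low_window N 0)) (ltry _).
  - by move=> M; exact: measurable_low_window.
  - move=> M M' MM'; apply/subsetPset => x [Ex wx]; split=> //=.
    apply: le_lt_trans wx; rewrite /window.
    have [NM|MN] := leqP N M; last by rewrite [leLHS]big_geq ?sume_ge0// ltnW.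
    by rewrite [leRHS](big_cat_nat NM MM')//= leeDl// sume_ge0.
have := (nonneg_cvg0P (fun M => measure_ge0 mu (low_window N M))).1 cv.
have e0 : 0 < 2^-1 ^+ N :> R by rewrite exprn_gt0// invr_gt0.
by move=> /(_ _ e0)[M _ /(_ M (leqnn M))]; exists M.
Qed.

Lemma coamenable_of_windows : coamenable (restr_prob mE E0) Q S.
Proof.
have [M MP] := choice low_window_small.
(* Window sums are left unnormalised: the mass stays at least 1 while the gap is bounded by a tail
   of a convergent series. *)
pose P N a := \sum_(N <= n < M N) p n a.
have P0 N a : 0 <= P N a by exact: sumr_ge0.
have PE N (A : set T) : (\esum_(a in A) (P N a)%:E =
    \sum_(N <= n < M N) \esum_(a in A) (p n a)%:E)%E.
  rewrite -esum_sum; last by move=> *; rewrite lee_fin.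
  by apply: eq_esum => a _; rewrite sumEFin.
have Pfin N : (l1norm (P N) < +oo)%E.
  rewrite (_ : l1norm _ = \esum_(a in [set: T]) (P N a)%:E); last first.
    by apply: eq_esum => a _; rewrite ger0_norm.
  rewrite PE; apply: lte_sum_pinfty => n _.
  by apply: le_lt_trans (pfin n); apply: le_esum => a _; rewrite lee_fin ler_norm.
have massE N x : mass P N x = window N (M N) x by exact: PE.
apply: (coamenable_of_mass cG hL hact sB P0 Pfin) => [k|].
  have tl := nneseries_tail_cvg (P := xpredT) (sum_gap_fin k) (fun n _ => gap0 n k).
  apply: (squeeze_cvge _ (cvg_cst 0%E) tl); apply: nearW => N; rewrite l1norm_ge0/=.
  apply: (@le_trans _ _ (\sum_(N <= n < M N) gap p n k)%E); last first.
    exact: nneseries_lim_ge.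
  rewrite /gap /l1norm -esum_sum; last by move=> *; rewrite lee_fin.
  apply: le_esum => a _; rewrite sumEFin lee_fin /P -sumrB; exact: ler_norm_sum.
(* Borel-Cantelli: the low windows have measures at most 2^-N, so almost every point lies in only
   finitely many of them. *)
pose bad := lim_sup_set (fun N => low_window N (M N)).
exists bad; split.
- apply: bigcap_measurable => // n _; apply: bigcup_measurable => N _.
  exact: measurable_low_window.
- apply: lim_sup_set_cvg0 => [N|]; first exact: measurable_low_window.
  apply: le_lt_trans nneseries_half; apply: lee_nneseries => // N _; exact: MP.
- move=> x /= /not_implyP[Ex nev] n _; apply: contrapT => nb; apply: nev.
  exists n => // N /= nN; rewrite massE leNgt; apply/negP => lt.
  by apply: nb; exists N.
Qed.

End Windows.

Theorem theorem1p4 (R : realType) (d : measure_display) (X : measurableType d)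
    (hX : standard_borel R X) (mu : probability X R)
    (Gam : groupType) (hGam : countable [set: Gam])
    (Lam : set Gam) (hLam : is_subgroup Lam)
    (act : Gam -> X -> X) (hact : pmp_action mu act) :
  (coamenable_subgroup R Lam ->
     everywhere_coamenable mu (orbit_rel act setT) (orbit_rel act Lam))
  /\
  (essentially_free mu act -> ~ coamenable_subgroup R Lam ->
     forall (E : set X) (mE : measurable E) (E0 : (0 < mu E)%E),
       ~ coamenable_on mE E0 (orbit_rel act setT) (orbit_rel act Lam)).
Proof.
have [B sB] := standard_borel_separated hX; split.
  move=> coL E mE E0; have [p [p0 p1 peps]] := reiter_of_coamenable hGam coL.
  exact: (coamenable_of_windows hGam hLam hact sB p0 p1 peps).
move=> free ncoL E mE E0 [xi [xiL2 xi1 xic]]; apply: ncoL.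
have /countable_injP[h /in2TT hinj] := hGam.
have mxi n : quot_borel_fun _ _ _ (xi n) := (xiL2 n).1.
have aeg := ae_good hGam hact free xi1 xic.
exact: (coamenable_of_almost_invariant hGam hLam hact sB hinj mxi aeg).
Qed.
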